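(* Let $p$ be a prime, let $\pi_\alpha(x)=|x|_p^{\alpha-1}\pi_1(x)$ be a multiplicative character of $\mathbb{Q}_p$, let $\rho$ be an automodel function on $\mathbb{Q}_p^*$ of degree $\pi_\alpha$, and let $\pi_0(x)=|x|_p^{-1}$. A distribution $f\in\mathcal{D}'(\mathbb{Q}_p)$ has a quasi-asymptotics of degree $\pi_{\alpha}$ at infinity with respect to $\rho(t)$, i.e., for some constant $C\neq 0$, $$f(x)\stackrel{\mathcal{D}'}{\sim}g(x)=\begin{cases}C|x|_p^{\alpha-1}\pi_1(x),&\pi_\alpha\ne\pi_0,\\ C\delta(x),&\pi_\alpha=\pi_0,\end{cases}\qquad|x|_p\to\infty\ \big(\rho(t)\big),$$ if and only if its Fourier transform $F[f]$ has a quasi-asymptotics of degree $\pi_{\alpha+1}^{-1}$ at zero with respect to $|t|_p\rho(t)$, i.e., with the same constant $C$, $$F[f](\xi)\stackrel{\mathcal{D}'}{\sim}F[g](\xi)=\begin{cases}C\,\Gamma_p(\pi_\alpha)|\xi|_p^{-\alpha}\pi_1^{-1}(\xi),&\pi_\alpha\neq\pi_0,\\ C,&\pi_\alpha=\pi_0,\end{cases}\qquad|\xi|_p\to0\ \big(|t|_p\rho(t)\big).$$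
   Context: $\mathbb{Q}_p$ has norm $|p|_p=p^{-1}$ and Haar measure $dx$ giving $B_0=\{|x|_p\le1\}$ measure $1$; $\mathbb{Q}_p^*=\mathbb{Q}_p\setminus\{0\}$. $\mathcal{D}(\mathbb{Q}_p)$ is the space of locally constant compactly supported functions $\mathbb{Q}_p\to\mathbb{C}$; $\mathcal{D}'(\mathbb{Q}_p)$ is the space of all linear functionals on it, with weak convergence; $\delta$ is the delta function at $0$. $F[\varphi](\xi)=\int_{\mathbb{Q}_p}\chi_p(\xi x)\varphi(x)\,dx$, $\chi_p(x)=e^{2\pi i\{x\}_p}$, $\{\cdot\}_p$ the $p$-adic fractional part; $\langle F[f],\varphi\rangle=\langle f,F[\varphi]\rangle$ for $f\in\mathcal{D}'$. For $f\in\mathcal{D}'(\mathbb{Q}_p)$, $t\in\mathbb{Q}_p^*$: $\langle f(tx),\varphi(x)\rangle=|t|_p^{-1}\langle f(x),\varphi(x/t)\rangle$. Multiplicative characters of $\mathbb{Q}_p$ have the form $\pi_\alpha(x)=|x|_p^{\alpha-1}\pi_1(x)$, $\alpha\in\mathbb{C}$, where $\pi_1$ is a normed character: $\pi_1(x)=\pi_1(|x|_px)$, $\pi_1(p)=1$, $|\pi_1|=1$. Correspondingly $\pi_{\alpha+1}(x)=|x|_p^{\alpha}\pi_1(x)$. If $\pi_\alpha\ne\pi_0$, the distribution $\pi_\alpha=|x|_p^{\alpha-1}\pi_1(x)\in\mathcal{D}'(\mathbb{Q}_p)$ is $$\langle\pi_\alpha,\varphi\rangle=\int_{B_0}|x|_p^{\alpha-1}\pi_1(x)(\varphi(x)-\varphi(0))\,dx+\int_{\mathbb{Q}_p\setminus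 B_0}|x|_p^{\alpha-1}\pi_1(x)\varphi(x)\,dx+\varphi(0)I_0(\alpha),$$ with $I_0(\alpha)=0$ if $\pi_1\not\equiv1$ and $I_0(\alpha)=\frac{1-p^{-1}}{1-p^{-\alpha}}$ if $\pi_1\equiv1$. The distribution $|\xi|_p^{-\alpha}\pi_1^{-1}(\xi)$ is given by the same formula with $\alpha,\pi_1$ replaced by $1-\alpha,\pi_1^{-1}$. $\Gamma_p(\pi_\alpha)=F[\pi_\alpha](1)=\int_{\mathbb{Q}_p}|x|_p^{\alpha-1}\pi_1(x)\chi_p(x)\,dx$ is the $p$-adic $\Gamma$-function; for $\pi_1\equiv1$ it equals $\frac{1-p^{\alpha-1}}{1-p^{-\alpha}}$. An automodel function of degree $\pi_\alpha$ is a continuous $\rho:\mathbb{Q}_p^*\to\mathbb{C}$ with $\lim_{|t|_p\to\infty}\rho(tz)/\rho(t)=\pi_\alpha(z)$ for every $z\in\mathbb{Q}_p^*$. For an automodel $\rho$ of degree $\pi_\alpha$: $f$ has the quasi-asymptotics $g$ of degree $\pi_\alpha$ at infinity with respect to $\rho$, written $f(x)\stackrel{\mathcal{D}'}{\sim}g(x)$, $|x|_p\to\infty$ $(\rho(t))$, if $f(tx)/\rho(t)\to g(x)\not\equiv0$ in $\mathcal{D}'$ as $|t|_p\to\infty$; $f$ has the quasi-asymptotics $g$ of degree $\pi_\alpha^{-1}$ at zero with respect to $\rho$, written $f(x)\stackrel{\mathcal{D}'}{\sim}g(x)$, $|x|_p\to0$ $(\rho(t))$, if $f(x/t)/\rho(t)\to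 g(x)\not\equiv0$ in $\mathcal{D}'$ as $|t|_p\to\infty$.
   Formalization: When π_α≡1 the printed limit CΓ_p(π_α)|ξ|_p^{-α}π_1^{-1}(ξ) is 0 times the distribution |ξ|_p^{-1}, which is undefined (pole of I_0); in that case F[g] is stated to be Cδ(ξ), its true value. *)

(* Defs.v *)
From HB Require Import structures.
From mathcomp Require Import all_boot all_order all_algebra.
From mathcomp Require Import ring lra complex.
From mathcomp Require Import all_classical all_reals all_analysis.

Set Implicit Arguments.
Unset Strict Implicit.
Unset Printing Implicit Defensive.

Import Order.TTheory GRing.Theory Num.Theory.
Import numFieldNormedType.Exports.

Local Open Scope classical_set_scope.
Local Open Scope quotient_scope.
Local Open Scope ring_scope.

Section RationalNorm.
Variable p : nat.

(* the p-adic absolute value, on int and then on rat *)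
Definition znorm (n : int) : rat :=
  if n == 0 then 0 else (p%:R ^+ logn p `|n|%N)^-1.

Definition qnorm (x : rat) : rat := znorm (numq x) / znorm (denq x).

Hypothesis pp : prime p.

Let p_gt0 : 0 < p%:R :> rat. Proof. by rewrite ltr0n prime_gt0. Qed.

Lemma znorm_ge0 n : 0 <= znorm n.
Proof. by rewrite /znorm; case: ifP => // _; rewrite invr_ge0 exprn_ge0 ?ltW. Qed.

Lemma znorm_eq0 n : (znorm n == 0) = (n == 0).
Proof.
rewrite /znorm; have [_|_] := eqVneq n 0; first by rewrite eqxx.
by rewrite invr_eq0 expf_eq0 (gt_eqF p_gt0) andbF.
Qed.

Lemma znormM m n : znorm (m * n) = znorm m * znorm n.
Proof.
rewrite /znorm mulf_eq0; have [_|m0]/= := eqVneq m 0; first by rewrite mul0r.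
have [_|n0]/= := eqVneq n 0; first by rewrite mulr0.
by rewrite abszM lognM ?absz_gt0// exprD invfM.
Qed.

Lemma znorm_ultra m n : znorm (m + n) <= Num.max (znorm m) (znorm n).
Proof.
wlog mn : m n / (logn p `|m| <= logn p `|n|)%N => [H|].
  case/orP: (leq_total (logn p `|m|) (logn p `|n|)) => [/H//|/H].
  by rewrite addrC maxC.
have [->|m0] := eqVneq m 0; first by rewrite add0r le_max lexx orbT.
have [->|n0] := eqVneq n 0; first by rewrite addr0 le_max lexx.
rewrite le_max; apply/orP; left; rewrite /znorm (negbTE m0).
case: ifPn => [_|mn0]; first by rewrite invr_ge0 exprn_ge0 ?ltW.
rewrite lef_pV2 ?posrE ?exprn_gt0//.
rewrite ler_weXn2l ?ler1n ?prime_gt0// -pfactor_dvdn ?absz_gt0//.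
have d (k : int) : k != 0 -> (logn p `|m| <= logn p `|k|)%N ->
    (((p ^ logn p `|m|)%N : int) %| k)%Z.
  by move=> k0 H; rewrite /dvdz/= unfold_in/= pfactor_dvdn ?absz_gt0.
by have := rpredD (d _ m0 (leqnn _)) (d _ n0 mn); rewrite unfold_in.
Qed.

Lemma qnormE (a b : int) : b != 0 -> qnorm (a%:~R / b%:~R) = znorm a / znorm b.
Proof.
move=> b0; set x := _ / _; rewrite /qnorm.
have dx0 : denq x != 0 by rewrite denq_neq0.
apply/eqP; rewrite eqr_div ?znorm_eq0// -!znormM; apply/eqP; congr znorm.
apply: (@intr_inj rat); rewrite !rmorphM/=.
have /eqP := divq_num_den x; rewrite {3}/x eqr_div ?intr_eq0//.
by move/eqP.
Qed.

Lemma qnorm_ge0 x : 0 <= qnorm x.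
Proof. by rewrite /qnorm divr_ge0 ?znorm_ge0. Qed.

Lemma qnorm_eq0 x : (qnorm x == 0) = (x == 0).
Proof.
by rewrite /qnorm mulf_eq0 invr_eq0 !znorm_eq0 numq_eq0 (negbTE (denq_neq0 _)) orbF.
Qed.

Lemma qnorm0 : qnorm 0 = 0. Proof. by apply/eqP; rewrite qnorm_eq0. Qed.

Lemma qnormM x y : qnorm (x * y) = qnorm x * qnorm y.
Proof.
rewrite -{1}(divq_num_den x) -{1}(divq_num_den y) mulf_div -!rmorphM/=.
by rewrite qnormE ?mulf_neq0 ?denq_neq0// !znormM -mulf_div.
Qed.

Lemma qnorm1 : qnorm 1 = 1.
Proof. by rewrite /qnorm /znorm/= logn1 expr0 invr1 divr1. Qed.

Lemma qnormV x : qnorm x^-1 = (qnorm x)^-1.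
Proof.
have [->|x0] := eqVneq x 0; first by rewrite invr0 qnorm0 invr0.
have q0 : qnorm x != 0 by rewrite qnorm_eq0.
by apply: (mulfI q0); rewrite -qnormM !divff ?qnorm1.
Qed.

Lemma qnormN x : qnorm (- x) = qnorm x.
Proof.
rewrite -mulN1r qnormM; have -> : qnorm (-1) = 1; last by rewrite mul1r.
by rewrite /qnorm /znorm/= logn1 expr0 invr1 divr1.
Qed.

Lemma qnorm_ultra x y : qnorm (x + y) <= Num.max (qnorm x) (qnorm y).
Proof.
rewrite -{1}(divq_num_den x) -{1}(divq_num_den y) addf_div ?intr_eq0 ?denq_neq0//.
rewrite -!rmorphM/= -rmorphD/= qnormE ?mulf_neq0 ?denq_neq0//.
rewrite ler_pdivrMr; last by rewrite lt_neqAle znorm_ge0 eq_sym znorm_eq0 mulf_neq0 ?denq_neq0.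
rewrite (le_trans (znorm_ultra _ _))// !znormM.
have zx : znorm (denq x) != 0 by rewrite znorm_eq0 denq_neq0.
have zy : znorm (denq y) != 0 by rewrite znorm_eq0 denq_neq0.
rewrite /qnorm maxr_pMl ?mulr_ge0 ?znorm_ge0//.
by rewrite mulrA divfK// (mulrC (znorm (denq x))) mulrA divfK.
Qed.

Lemma qnorm_p : qnorm p%:R = p%:R^-1.
Proof.
have {1}-> : p%:R = p%:Z%:~R / 1%:Z%:~R :> rat by rewrite divr1.
rewrite qnormE// /znorm /=.
rewrite logn1 expr0 invr1 divr1 logn_prime// eqxx expr1.
by case: ifP => // /eqP [] E; move: pp; rewrite E.
Qed.

End RationalNorm.

Section Completion.
Variables (p : nat) (pp : prime p).
Implicit Types u v : nat -> rat.

Definition qcauchy u : Prop := forall e : rat, 0 < e ->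
  exists N, forall m n, (N <= m)%N -> (N <= n)%N -> qnorm p (u m - u n) < e.

Definition qnull u : Prop := forall e : rat, 0 < e ->
  exists N, forall n, (N <= n)%N -> qnorm p (u n) < e.

Lemma qdist_sym (x y : rat) : qnorm p (x - y) = qnorm p (y - x).
Proof. by rewrite -opprB qnormN. Qed.

Lemma qnull_cauchy u : qnull u -> qcauchy u.
Proof.
move=> nu e /nu[N uN]; exists N => m n Nm Nn.
by rewrite (le_lt_trans (qnorm_ultra _ _ _))// qnormN// gt_max !uN.
Qed.

Lemma qnorm_isosceles (x y : rat) : qnorm p (x - y) < qnorm p y ->
  qnorm p x = qnorm p y.
Proof.
move=> xy; apply/le_anti/andP; split.
  rewrite -{1}(subrK y x) (le_trans (qnorm_ultra pp _ _))//.
  by rewrite ge_max lexx (ltW xy).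
have := qnorm_ultra pp x (y - x); rewrite subrKC le_max => /orP[//|].
by rewrite qdist_sym leNgt xy.
Qed.

Lemma qcauchy_norm u : qcauchy u -> ~ qnull u ->
  exists2 c, 0 < c & exists N, forall n, (N <= n)%N -> qnorm p (u n) = c.
Proof.
move=> cu /existsNP[e /not_implyP[e0 /forallNP H]].
have [N uN] := cu e e0.
have /existsNP[m /not_implyP[Nm /negP]] := H N; rewrite -leNgt => um.
exists (qnorm p (u m)); first exact: lt_le_trans um.
by exists N => n Nn; apply: qnorm_isosceles; rewrite (lt_le_trans _ um)// uN.
Qed.

Lemma qcauchy_bounded u : qcauchy u ->
  exists2 B, 0 < B & exists N, forall n, (N <= n)%N -> qnorm p (u n) <= B.
Proof.
move=> /(_ 1 ltr01)[N uN]; exists (Num.max 1 (qnorm p (u N))).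
  by rewrite lt_max ltr01.
exists N => n Nn; rewrite -(subrK (u N) (u n)) (le_trans (qnorm_ultra pp _ _))//.
by rewrite ge_max !le_max lexx orbT andbT (ltW (uN _ _ _ _)).
Qed.

(* The unused primality argument makes the ring structure of the type qseq
   below inferable from that type. *)
Definition qcauchy_pred (_ : prime p) : {pred nat -> rat} :=
  fun u => `[< qcauchy u >].

Lemma qcauchy_subring : subring_closed (qcauchy_pred pp).
Proof.
split=> [|u v|u v].
- by apply/asboolP => e e0; exists 0%N => m n _ _; rewrite subrr qnorm0.
- move=> /asboolP cu /asboolP cv; apply/asboolP => e e0.
  have [N uN] := cu e e0; have [M vM] := cv e e0.
  exists (maxn N M) => m n; rewrite !geq_max => /andP[Nm Mm] /andP[Nn Mn].
  have -> : (u - v) m - (u - v) n = (u m - u n) + - (v m - v n).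
    by rewrite !fctE; ring.
  by rewrite (le_lt_trans (qnorm_ultra pp _ _))// qnormN// gt_max uN// vM.
- move=> /asboolP cu /asboolP cv; apply/asboolP => e e0.
  have [B B0 [N uB]] := qcauchy_bounded cu.
  have [D D0 [M vD]] := qcauchy_bounded cv.
  have [N' uN] := cu (e / D) (divr_gt0 e0 D0).
  have [M' vM] := cv (e / B) (divr_gt0 e0 B0).
  exists (maxn (maxn N M) (maxn N' M')) => m n.
  rewrite !geq_max => /andP[/andP[Nm Mm] /andP[Nm' Mm']].
  move=> /andP[/andP[Nn Mn] /andP[Nn' Mn']].
  have -> : (u * v) m - (u * v) n = u m * (v m - v n) + (u m - u n) * v n.
    by rewrite !fctE; ring.
  rewrite (le_lt_trans (qnorm_ultra pp _ _))// !qnormM// gt_max; apply/andP; split.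
    rewrite (le_lt_trans (ler_wpM2r (qnorm_ge0 p _) (uB _ Nm)))//.
    by rewrite mulrC -ltr_pdivlMr// vM.
  rewrite (le_lt_trans (ler_wpM2l (qnorm_ge0 p _) (vD _ Mn)))//.
  by rewrite -ltr_pdivlMr// uN.
Qed.

HB.instance Definition _ :=
  GRing.isSubringClosed.Build (nat -> rat) (qcauchy_pred pp)
    qcauchy_subring.

Record qseq := QSeq { qseq_val :> nat -> rat; _ : qseq_val \in qcauchy_pred pp }.

HB.instance Definition _ := [isSub for qseq_val].
HB.instance Definition _ := [Choice of qseq by <:].
HB.instance Definition _ := [SubChoice_isSubComNzRing of qseq by <:].

Lemma qseqP (u : qseq) : qcauchy u. Proof. by case: u => u /= /asboolP. Qed.

Definition null_pred : pred qseq := [pred u : qseq | `[< qnull u >]].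

Lemma null_ideal : idealr_closed null_pred.
Proof.
split.
- by apply/asboolP => e e0; exists 0%N => n _; rewrite qnorm0.
- apply/negP => /asboolP /(_ 1 ltr01)[N /(_ N (leqnn N))].
  by rewrite qnorm1 ltxx.
move=> a u v /asboolP nu /asboolP nv; apply/asboolP => e e0.
have [B B0 [N aB]] := qcauchy_bounded (qseqP a).
have [M uM] := nu _ (divr_gt0 e0 B0); have [M' vM] := nv _ e0.
exists (maxn N (maxn M M')) => n; rewrite !geq_max => /and3P[Nn Mn Mn'].
rewrite (le_lt_trans (qnorm_ultra pp (a n * u n) (v n)))// gt_max vM// andbT.
rewrite qnormM// (le_lt_trans (ler_wpM2r (qnorm_ge0 p _) (aB _ Nn)))//.
by rewrite mulrC -ltr_pdivlMr// uM.
Qed.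

HB.instance Definition _ := isIdealr.Build qseq null_pred null_ideal.

Definition null_idealr : idealr qseq := null_pred.

(* The completion of the rationals: Cauchy sequences modulo null sequences. *)
Definition Qp : Type := {ideal_quot null_idealr}.
HB.instance Definition _ := GRing.ComNzRing.on Qp.

End Completion.

Section QpField.
Variables (p : nat) (pp : prime p).
Local Notation Qp := (Qp pp).
Local Notation qseq := (qseq pp).

Lemma Qp_piE (u v : qseq) :
  (\pi_Qp u = \pi_Qp v) <-> qnull p (fun n => u n - v n).
Proof.
have := Quotient.idealrBE (null_idealr pp) u v.
move=> E; split=> [uv|uv].
  have : u - v \in null_idealr pp by rewrite E; apply/eqP.
  by move=> /asboolP.
by apply/eqP; rewrite -[_ == _]E; apply/asboolP.
Qed.

Lemma Qp_inv_ex (x : Qp) : x != 0 -> exists y : Qp, y * x = 1.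
Proof.
rewrite -[x]reprK; set u : qseq := repr x => u0.
have nu : ~ qnull p u.
  move=> nu; move/eqP: u0; apply.
  rewrite -[0](rmorph0 (\pi_Qp : {rmorphism qseq -> Qp})); apply/Qp_piE => e /nu[N uN].
  by exists N => n /uN; rewrite subr0.
have [c c0 [N uN]] := qcauchy_norm pp (qseqP u) nu.
have u_neq0 n : (N <= n)%N -> u n != 0.
  by move=> Nn; rewrite -(qnorm_eq0 pp) uN// gt_eqF.
have cv : qcauchy p (fun n => (u n)^-1).
  move=> e e0; have [M uM] := qseqP u (mulr_gt0 e0 (mulr_gt0 c0 c0)).
  exists (maxn N M) => m n; rewrite !geq_max => /andP[Nm Mm] /andP[Nn Mn].
  have -> : (u m)^-1 - (u n)^-1 = (u n - u m) / (u m * u n).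
    by field; rewrite !u_neq0.
  rewrite qnormM// qnormV// qnormM// !uN// ltr_pdivrMr ?mulr_gt0//.
  exact: uM.
pose v : qseq := QSeq (introT (asboolP (qcauchy p (fun n => (u n)^-1))) cv).
exists (\pi_Qp v); rewrite -rmorphM -[1](rmorph1 (\pi_Qp : {rmorphism qseq -> Qp})).
apply/Qp_piE => e e0; exists N => n Nn.
have -> : (v * u) n - (1 : qseq) n = (u n)^-1 * u n - 1 by [].
by rewrite mulVf ?u_neq0// subrr qnorm0.
Qed.

Definition Qp_inv (x : Qp) : Qp := xget 0 [set y | y * x = 1].

Lemma Qp_mulVf (x : Qp) : x != 0 -> Qp_inv x * x = 1.
Proof. by move=> /Qp_inv_ex xV; exact: (xgetPex 0 xV). Qed.

Lemma Qp_invr0 : Qp_inv 0 = 0.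
Proof.
rewrite /Qp_inv; case: xgetP => // y _ /=; rewrite mulr0 => /esym/eqP.
by rewrite oner_eq0.
Qed.

HB.instance Definition _ := GRing.ComNzRing_isField.Build Qp Qp_mulVf Qp_invr0.

Lemma Qp_pi_cst_subproof (q : rat) : (fun _ : nat => q) \in qcauchy_pred pp.
Proof. by apply/asboolP => e e0; exists 0%N => m n _ _; rewrite subrr qnorm0. Qed.

Definition Qp_of_rat (q : rat) : Qp := \pi_Qp (QSeq (Qp_pi_cst_subproof q) : qseq).

Lemma Qp_of_ratE : Qp_of_rat =1 ratr.
Proof.
have zm : zmod_morphism Qp_of_rat.
  move=> x y; rewrite /Qp_of_rat -rmorphB; apply/Qp_piE => e e0.
  by exists 0%N => n _; rewrite subrr qnorm0.
have mm : monoid_morphism Qp_of_rat.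
  split.
    transitivity (\pi_Qp (1 : qseq) : Qp); last exact: rmorph1.
    by apply/Qp_piE => e e0; exists 0%N => n _; rewrite subrr qnorm0.
  move=> x y; rewrite /Qp_of_rat -rmorphM; apply/Qp_piE => e e0.
  by exists 0%N => n _; rewrite subrr qnorm0.
pose f1 := GRing.isZmodMorphism.Build _ _ _ zm.
pose f2 := GRing.isMonoidMorphism.Build _ _ _ mm.
pose f : {rmorphism rat -> Qp} := HB.pack Qp_of_rat f1 f2.
exact: (fmorph_eq_rat f).
Qed.

Definition qnorm_lim (u : nat -> rat) : set rat := [set l |
  forall e : rat, 0 < e ->
    exists N, forall n, (N <= n)%N -> `|qnorm p (u n) - l| < e].

(* The p-adic norm, valued in rat: the limit of the norms of the terms of a
   sequence representing x. *)
Definition pnorm (x : Qp) : rat := xget 0 (qnorm_lim (repr x : qseq)).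

Lemma qnorm_lim_ex (u : nat -> rat) : qcauchy p u -> exists l, qnorm_lim u l.
Proof.
move=> cu; have [nu|nu] := pselect (qnull p u).
  exists 0 => e /nu[N uN]; exists N => n Nn.
  by rewrite subr0 ger0_norm ?uN ?qnorm_ge0.
have [c c0 [N uN]] := qcauchy_norm pp cu nu.
by exists c => e e0; exists N => n Nn; rewrite uN// subrr normr0.
Qed.

Lemma qnorm_lim_eq (u v : nat -> rat) l l' : qnull p (fun n => u n - v n) ->
  qnorm_lim u l -> qnorm_lim v l' -> l = l'.
Proof.
move=> uv ul vl; apply/eqP; rewrite -subr_eq0 -normr_le0.
apply/ler_addgt0Pl => e e0; rewrite addr0.
have e3 : 0 < e / 3%:R by rewrite divr_gt0.
have [N1 H1] := uv _ e3; have [N2 H2] := ul _ e3; have [N3 H3] := vl _ e3.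
pose n := maxn N1 (maxn N2 N3).
have {}H1 := H1 n (leq_maxl _ _).
have {}H2 := H2 n (leq_trans (leq_maxl _ _) (leq_maxr _ _)).
have {}H3 := H3 n (leq_trans (leq_maxr _ _) (leq_maxr _ _)).
have {H1}uv1 : `|qnorm p (u n) - qnorm p (v n)| < e / 3%:R.
  have A1 := qnorm_ultra pp (u n - v n) (v n); rewrite subrK in A1.
  have A2 := qnorm_ultra pp (v n - u n) (u n); rewrite subrK in A2.
  rewrite (qdist_sym pp) in A2.
  have := qnorm_ge0 p (u n); have := qnorm_ge0 p (v n).
  have := qnorm_ge0 p (u n - v n).
  move: A1 A2; rewrite !le_max ltr_norml => /orP[] A1 /orP[] A2 *;
    apply/andP; split; lra.
by move: H2 H3 uv1; rewrite !ltr_norml ler_norml => /andP[? ?] /andP[? ?] /andP[? ?];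
  apply/andP; split; lra.
Qed.

Lemma pnormP (x : Qp) : qnorm_lim (repr x : qseq) (pnorm x).
Proof. exact: (xgetPex 0 (qnorm_lim_ex (qseqP _))). Qed.

Lemma pnorm_pi (u : qseq) l : qnorm_lim u l -> pnorm (\pi_Qp u) = l.
Proof.
move=> ul; apply: qnorm_lim_eq (pnormP _) ul.
by apply/Qp_piE; rewrite reprK.
Qed.

Lemma pnorm_ratr (q : rat) : pnorm (ratr q) = qnorm p q.
Proof.
rewrite -Qp_of_ratE; apply: pnorm_pi => e e0.
by exists 0%N => n _; rewrite subrr normr0.
Qed.

Lemma pnorm0 : pnorm 0 = 0.
Proof. by have := pnorm_ratr 0%:R; rewrite ratr_nat qnorm0. Qed.

Lemma pnorm_ge0 (x : Qp) : 0 <= pnorm x.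
Proof.
apply/ler_addgt0Pl => e e0; have [N /(_ N (leqnn N))] := pnormP x e0.
rewrite ltr_norml => /andP[_]; have := qnorm_ge0 p ((repr x : qseq) N); lra.
Qed.

Lemma pnorm_eq0 (x : Qp) : (pnorm x == 0) = (x == 0).
Proof.
apply/eqP/eqP => [x0|->]; last exact: pnorm0.
have := pnormP x; rewrite x0 => lx.
rewrite -[x]reprK -[0](rmorph0 (\pi_Qp : {rmorphism qseq -> Qp})).
apply/Qp_piE => e /lx[N xN]; exists N => n /xN.
by rewrite !subr0 ger0_norm ?qnorm_ge0.
Qed.

Lemma pnorm_evt (x : Qp) : x != 0 ->
  exists N, forall n, (N <= n)%N -> qnorm p ((repr x : qseq) n) = pnorm x.
Proof.
move=> x0; have nu : ~ qnull p (repr x : qseq).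
  move=> nu; move/eqP: x0; apply.
  rewrite -[x]reprK -[0](rmorph0 (\pi_Qp : {rmorphism qseq -> Qp})).
  by apply/Qp_piE => e /nu[N uN]; exists N => n /uN; rewrite subr0.
have [c c0 [N uN]] := qcauchy_norm pp (qseqP (repr x)) nu.
exists N => n Nn; rewrite uN//; apply/esym.
apply: (@qnorm_lim_eq (repr x : qseq) (repr x : qseq)) (pnormP x) _.
  by move=> e e0; exists 0%N => k _; rewrite subrr qnorm0.
by move=> e e0; exists N => k Nk; rewrite uN// subrr normr0.
Qed.

Lemma pnormM (x y : Qp) : pnorm (x * y) = pnorm x * pnorm y.
Proof.
have [->|x0] := eqVneq x 0; first by rewrite !(mul0r, pnorm0).
have [->|y0] := eqVneq y 0; first by rewrite !(mulr0, pnorm0).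
have [N xN] := pnorm_evt x0; have [M yM] := pnorm_evt y0.
rewrite -{1}[x]reprK -{1}[y]reprK -rmorphM; apply: pnorm_pi => e e0.
exists (maxn N M) => n; rewrite geq_max => /andP[Nn Mn].
have -> : ((repr x : qseq) * (repr y : qseq)) n =
  (repr x : qseq) n * (repr y : qseq) n by [].
by rewrite qnormM// xN// yM// subrr normr0.
Qed.

Lemma pnorm_ultra (x y : Qp) : pnorm (x + y) <= Num.max (pnorm x) (pnorm y).
Proof.
set u := repr x : qseq; set v := repr y : qseq.
have [l uvl] := qnorm_lim_ex (qseqP (u + v)).
have -> : pnorm (x + y) = l.
  by rewrite -[x]reprK -[y]reprK -rmorphD; exact: pnorm_pi.
rewrite leNgt gt_max; apply/negP => /andP[xl yl].
have [N1 H1] := pnormP x (divr_gt0 (etrans (subr_gt0 _ _) xl) (ltr0n rat 2)).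
have [N2 H2] := pnormP y (divr_gt0 (etrans (subr_gt0 _ _) yl) (ltr0n rat 2)).
pose e := Num.min ((l - pnorm x) / 2%:R) ((l - pnorm y) / 2%:R).
have e0 : 0 < e by rewrite lt_min !divr_gt0 ?subr_gt0.
have [N3 H3] := uvl _ e0.
pose n := maxn N1 (maxn N2 N3).
have {}H1 := H1 n (leq_maxl _ _).
have {}H2 := H2 n (leq_trans (leq_maxl _ _) (leq_maxr _ _)).
have {}H3 := H3 n (leq_trans (leq_maxr _ _) (leq_maxr _ _)).
have := qnorm_ultra pp (u n) (v n).
move: H1 H2 H3; rewrite lt_min le_max !ltr_norml.
have -> : (u + v) n = u n + v n by [].
move=> /andP[_ H1] /andP[_ H2] /andP[/andP[H3 _] /andP[H4 _]] /orP[] H5.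
  move: H1 H3 H5; rewrite -/u; lra.
move: H2 H4 H5; rewrite -/v; lra.
Qed.

Lemma pnormN (x : Qp) : pnorm (- x) = pnorm x.
Proof.
have E : pnorm (-1) = 1.
  rewrite [-1](_ : _ = ratr (-1)%:~R); last by rewrite ratr_int.
  by rewrite pnorm_ratr rmorphN1 qnormN// qnorm1.
by rewrite -mulN1r pnormM E mul1r.
Qed.

Lemma pnorm_p : pnorm p%:R = p%:R^-1.
Proof. by rewrite -[p%:R](ratr_nat Qp) pnorm_ratr qnorm_p. Qed.

Lemma pnorm1 : pnorm 1 = 1.
Proof. by have := pnorm_ratr 1%:R; rewrite ratr_nat qnorm1. Qed.

Lemma pnormX (x : Qp) n : pnorm (x ^+ n) = pnorm x ^+ n.
Proof. by elim: n => [|n IH]; rewrite ?expr0 ?pnorm1// !exprS pnormM IH. Qed.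

Lemma pnormV (x : Qp) : pnorm x^-1 = (pnorm x)^-1.
Proof.
have [->|x0] := eqVneq x 0; first by rewrite invr0 pnorm0 invr0.
have q0 : pnorm x != 0 by rewrite pnorm_eq0.
by apply: (mulfI q0); rewrite -pnormM !divff ?pnorm1.
Qed.

Definition pdist (x y : Qp) : rat := pnorm (x - y).

Lemma pdistxx x : pdist x x = 0. Proof. by rewrite /pdist subrr pnorm0. Qed.

Lemma pdist_positivity x y : pdist x y = 0 -> x = y.
Proof. by move=> /eqP; rewrite pnorm_eq0 subr_eq0 => /eqP. Qed.

Lemma pdist_sym x y : pdist x y = pdist y x.
Proof. by rewrite /pdist -opprB pnormN. Qed.

Lemma pdist_triangle y x z : pdist x z <= pdist x y + pdist y z.
Proof.
rewrite /pdist -(subrKA y) (le_trans (pnorm_ultra _ _))// ge_max.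
by rewrite lerDl lerDr !pnorm_ge0.
Qed.

HB.instance Definition _ :=
  isMetric.Build rat Qp pdistxx pdist_positivity pdist_sym pdist_triangle.
HB.instance Definition _ := isPointed.Build Qp 0.

Lemma Qp_dense (x : Qp) (e : rat) : 0 < e -> exists q, pdist x (ratr q) < e.
Proof.
move=> e0; have [N uN] := qseqP (repr x) (divr_gt0 e0 (ltr0n rat 2)).
exists ((repr x : qseq) N).
rewrite -Qp_of_ratE /pdist -{1}[x]reprK /Qp_of_rat -rmorphB.
set w : qseq := _ - _; have [l wl] := qnorm_lim_ex (qseqP w).
rewrite (pnorm_pi wl); have [M] := wl _ (divr_gt0 e0 (ltr0n rat 2)).
move=> /(_ (maxn N M) (leq_maxr _ _)).
have -> : w (maxn N M) = (repr x : qseq) (maxn N M) - (repr x : qseq) N by [].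
have := uN (maxn N M) N (leq_maxl _ _) (leqnn _).
by rewrite ltr_norml => H /andP[+ _]; lra.
Qed.

Lemma Qp_complete (x : nat -> Qp) :
  (forall e : rat, 0 < e -> exists N, forall m n,
     (N <= m)%N -> (N <= n)%N -> pdist (x m) (x n) < e) ->
  exists l : Qp, x @ \oo --> l.
Proof.
move=> cx.
have qE (n : nat) : exists q, pdist (x n) (ratr q) < n.+1%:R^-1.
  by apply: Qp_dense; rewrite invr_gt0.
have [q qx] := choice qE.
have small (e : rat) : 0 < e -> exists N, forall n, (N <= n)%N ->
    pdist (x n) (ratr (q n)) < e.
  move=> e0; exists (Num.truncn e^-1) => n Nn; rewrite (lt_trans (qx n))//.
  rewrite -[e]invrK ltf_pV2 ?posrE ?invr_gt0//.
  by rewrite (lt_le_trans (truncnS_gt _))// ler_nat ltnS.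
have cq : qcauchy p q.
  move=> e e0; have [N xN] := cx _ (divr_gt0 e0 (ltr0n rat 3)).
  have [M qM] := small _ (divr_gt0 e0 (ltr0n rat 3)).
  exists (maxn N M) => m n; rewrite !geq_max => /andP[Nm Mm] /andP[Nn Mn].
  have <- : pdist (ratr (q m)) (ratr (q n)) = qnorm p (q m - q n).
    rewrite /pdist -!Qp_of_ratE /Qp_of_rat -rmorphB; apply: pnorm_pi => d d0.
    by exists 0%N => k _; rewrite subrr normr0.
  have A1 := pdist_triangle (x m) (ratr (q m)) (ratr (q n)).
  have A2 := pdist_triangle (x n) (x m) (ratr (q n)).
  move: (xN m n Nm Nn) (qM m Mm) (qM n Mn); rewrite (pdist_sym (x m) (ratr _)); lra.
pose u : qseq := QSeq (introT (asboolP _) cq : q \in qcauchy_pred pp).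
exists (\pi_Qp u : Qp); apply/cvg_ballP => e e0.
have [N uN] := cq _ (divr_gt0 e0 (ltr0n rat 3)).
have [M qM] := small _ (divr_gt0 e0 (ltr0n rat 3)).
exists (maxn N M) => // n /=; rewrite geq_max => /andP[Nn Mn].
rewrite ballEmdist; change (pdist (\pi_Qp u) (x n) < e).
suff : pdist (\pi_Qp u) (ratr (q n)) <= e / 3%:R.
  have := pdist_triangle (ratr (q n)) (\pi_Qp u) (x n).
  have := qM n Mn; rewrite (pdist_sym (x n)); lra.
rewrite /pdist -Qp_of_ratE /Qp_of_rat -rmorphB.
set w : qseq := _ - _; have [l wl] := qnorm_lim_ex (qseqP w).
rewrite (pnorm_pi wl) leNgt; apply/negP => el.
have [K] := wl _ (etrans (subr_gt0 _ _) el).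
move=> /(_ (maxn N K) (leq_maxr _ _)).
have -> : w (maxn N K) = q (maxn N K) - q n by [].
have := uN _ n (leq_maxl N K) Nn.
by rewrite ltr_norml => H /andP[+ _]; lra.
Qed.

End QpField.

Section Neighbourhoods.
Variables (p : nat) (pp : prime p).

Definition Qp_star : set (Qp pp) := [set x | x != 0].

Definition Qp_ball0 : set (Qp pp) := [set x | pnorm x <= 1].

Definition Qp_infty : set_system (Qp pp) :=
  filter_from [set: rat] (fun M => [set t : Qp pp | M < pnorm t]).

Global Instance Qp_infty_proper : ProperFilter Qp_infty.
Proof.
apply: filter_from_proper.
  apply: filter_from_filter => [|M N _ _]; first by exists 0.
  by exists (Num.max M N) => // t /=; rewrite gt_max => /andP.
move=> M _; exists (p%:R ^- (Num.truncn M).+1) => /=.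
rewrite pnormV pnormX pnorm_p exprVn invrK (lt_trans (truncnS_gt _))//.
by rewrite -natrX ltr_nat ltn_expl// prime_gt1.
Qed.

End Neighbourhoods.

Arguments Qp_star {p} pp.
Arguments Qp_ball0 {p} pp.
Arguments Qp_infty {p} pp.

(* The ascription gives the complex numbers the topology of a numFieldType. *)
Definition Cplx (R : realType) : numClosedFieldType := R[i].

Notation Qp_borel pp := (g_sigma_algebraType (@open (Qp pp))).

Section Analysis.
Variables (R : realType) (p : nat) (pp : prime p).
Local Notation C := (Cplx R).
Local Notation Qp := (Qp pp).

Definition normR (x : Qp) : R := ratr (pnorm x).

Definition cis (x : R) : C := (cos x +i* sin x)%C.

(* r ^ a for r > 0 and a complex exponent a *)
Definition cpow (r : R) (a : C) : C :=
  (r `^ complex.Re a)%:C%C * cis (complex.Im a * ln r).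

(* {x}_p, the element of Z[1/p] in [0, 1[ such that x - {x}_p is in Z_p *)
Definition frac_part (x : Qp) : rat := xget 0 [set q : rat |
  [/\ 0 <= q < 1, exists n, q * p%:R ^+ n \is a Num.int
    & pnorm (x - ratr q) <= 1]].

Definition chi (x : Qp) : C := cis (2 * pi * ratr (frac_part x)).

Definition normed_char (pi1 : Qp -> C) : Prop :=
  [/\ forall x y, x != 0 -> y != 0 -> pi1 (x * y) = pi1 x * pi1 y,
      {within Qp_star pp, continuous pi1},
      forall x, x != 0 -> pi1 x = pi1 (ratr (pnorm x) * x),
      pi1 p%:R = 1
    & forall x, x != 0 -> `|pi1 x| = 1].

(* Only the values outside 0 are meaningful. *)
Definition mchar (alpha : C) (pi1 : Qp -> C) (x : Qp) : C :=
  cpow (normR x) (alpha - 1) * pi1 x.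

Definition pi0 (x : Qp) : C := ((normR x)^-1)%:C%C.

Definition testfun (phi : Qp -> C) : Prop :=
  (forall x, \forall y \near x, phi y = phi x) /\
  compact (closure [set x | phi x != 0]).

(* A distribution is represented by a functional on all functions, of which
   only the values on test functions matter: see dist_eq for equality. *)
Definition functional := (Qp -> C) -> C.

Definition is_distribution (f : functional) : Prop :=
  forall (a : C) (phi psi : Qp -> C), testfun phi -> testfun psi ->
    f (fun x => a * phi x + psi x) = a * f phi + f psi.

Definition dist_eq (f g : functional) : Prop :=
  forall phi, testfun phi -> f phi = g phi.

Definition dscale (c : C) (f : functional) : functional := fun phi => c * f phi.

Definition delta : functional := fun phi => phi 0.

(* f(t x), for t != 0 *)
Definition dilate (f : functional) (t : Qp) : functional :=
  fun phi => ((normR t)^-1)%:C%C * f (fun x => phi (x / t)).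

Variable mu : {measure set (Qp_borel pp) -> \bar R}.

Definition normalized_haar : Prop :=
  (forall (a : Qp) (A : set (Qp_borel pp)), measurable A ->
     mu [set a + x | x in (A : set Qp)] = mu A) /\
  mu (Qp_ball0 pp) = 1%E.

Definition cintegral (D : set Qp) (f : Qp -> C) : C :=
  ((\int[mu]_(x in (D : set (Qp_borel pp))) complex.Re (f x))
   +i* (\int[mu]_(x in (D : set (Qp_borel pp))) complex.Im (f x)))%C.

Definition fourier (phi : Qp -> C) (xi : Qp) : C :=
  cintegral [set: Qp] (fun x => chi (xi * x) * phi x).

Definition dfourier (f : functional) : functional := fun phi => f (fourier phi).

(* the distribution defined by the constant function 1 *)
Definition dconst1 : functional := cintegral [set: Qp].

Definition I0 (alpha : C) (pi1 : Qp -> C) : C :=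
  if `[< forall x, x != 0 -> pi1 x = 1 >]
  then (1 - p%:R^-1) / (1 - cpow p%:R (- alpha)) else 0.

Definition dmchar (alpha : C) (pi1 : Qp -> C) : functional := fun phi =>
  cintegral (Qp_ball0 pp) (fun x => mchar alpha pi1 x * (phi x - phi 0)) +
  cintegral (~` Qp_ball0 pp) (fun x => mchar alpha pi1 x * phi x) +
  phi 0 * I0 alpha pi1.

(* The value at a of a distribution which is a continuous function near a:
   the limit of its averages over the balls a + p^n Z_p, of measure p^-n. *)
Definition point_value (f : functional) (a : Qp) : C :=
  lim ((p%:R ^+ n * f (fun x => if pnorm (x - a) <= p%:R ^- n then 1 else 0))
         @[n --> \oo]).

(* Gamma_p = F[pi_alpha](1) *)
Definition Gamma_p (alpha : C) (pi1 : Qp -> C) : C :=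
  point_value (dfourier (dmchar alpha pi1)) 1.

Definition automodel (deg rho : Qp -> C) : Prop :=
  {within Qp_star pp, continuous rho} /\
  forall z, z != 0 -> rho (t * z) / rho t @[t --> Qp_infty pp] --> deg z.

Definition qasympt_infty (deg rho : Qp -> C) (f g : functional) : Prop :=
  [/\ automodel deg rho, is_distribution g, ~ dist_eq g (fun=> 0)
    & forall phi, testfun phi ->
        dilate f t phi / rho t @[t --> Qp_infty pp] --> g phi].

(* f ~ g at zero with respect to rho; here deg is the degree of rho, so
   that the degree of the quasi-asymptotics is deg^-1. *)
Definition qasympt_zero (deg rho : Qp -> C) (f g : functional) : Prop :=
  [/\ automodel deg rho, is_distribution g, ~ dist_eq g (fun=> 0)
    & forall phi, testfun phi ->
        dilate f t^-1 phi / rho t @[t --> Qp_infty pp] --> g phi].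

Definition infty_limit (c alpha : C) (pi1 : Qp -> C) : functional :=
  if `[< forall x, x != 0 -> mchar alpha pi1 x = pi0 x >] then dscale c delta
  else dscale c (dmchar alpha pi1).

(* If pi_alpha = 1 then Gamma_p(pi_alpha) = 0 while |xi|^-alpha pi1^-1 = |xi|^-1
   has a pole; their product stands for its limit, as a function of alpha,
   which is delta = F[1]. *)
Definition zero_limit (c alpha : C) (pi1 : Qp -> C) : functional :=
  if `[< forall x, x != 0 -> mchar alpha pi1 x = pi0 x >] then dscale c dconst1
  else if `[< forall x, x != 0 -> mchar alpha pi1 x = 1 >]
  then dscale c delta
  else dscale (c * Gamma_p alpha pi1)
         (dmchar (1 - alpha) (fun x => (pi1 x)^-1)).

End Analysis.

(* Main.v *)
Require Import Defs.
From HB Require Import structures.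
From mathcomp Require Import all_boot all_order all_algebra.
From mathcomp Require Import zify ring lra complex.
From mathcomp Require Import all_classical all_reals all_analysis measurable_realfun.

(** The Fourier transform F is an invertible linear operator on test functions
    that turns phi(x/z) into |z| (F phi)(z x).  Hence the rescaled functional
    of F[f] at zero, tested on phi, is the rescaled functional of f at infinity
    tested on F phi, and the two quasi-asymptotics correspond by g |-> F[g].

    A quasi-asymptotics of degree pi is homogeneous: G(phi(x/z)) =
    |z| pi(z) G(phi).  The test functions vanishing at 0 are combinations of
    indicators of balls a(1 + p^n Z_p), n large, and homogeneity determines G
    there up to a constant; so G = c pi on them.  If pi <> pi_0 the remaining
    freedom, a multiple of delta, has the wrong degree; if pi = pi_0, testing
    on the unit sphere shows c = 0 and G is a multiple of delta.

    The Fourier transform of a homogeneous distribution is homogeneous of the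
    dual degree, hence F[pi_alpha] is a multiple of the dual character; the
    factor is the value at 1, which is Gamma_p. *)

Set Implicit Arguments.
Unset Strict Implicit.
Unset Printing Implicit Defensive.

Import Order.TTheory GRing.Theory Num.Theory.
Import numFieldNormedType.Exports.

Local Open Scope classical_set_scope.
Local Open Scope ring_scope.

(** * Arithmetic and topology of the p-adic field *)

(** Haar measure enters only through translation invariance and mu(Z_p) = 1. These fix the measure
    of every ball, and a test function is a finite combination of indicators of balls, so identities
    between integrals, Fourier transforms and functionals are all checked on balls.

    The character pi_alpha is singular at 0, and its distribution integrates it only against phi -
    phi(0) 1_{Z_p}. A homogeneous distribution is accordingly studied through two pieces: its
    restriction to test functions vanishing at 0, and its value on 1_{Z_p}. The constant [I0] is
    this second value for pi_alpha. The degree pi_0 is exceptional because there pi_{alpha+1} = 1: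
    dilations act trivially and delta cannot be excluded. Dually, pi_alpha = 1 is set apart on the
    Fourier side, because its dual degree is pi_0; its transform delta comes from Fourier inversion
    at 0.

    Only limits at infinity are classified. A limit at zero is carried back to infinity by the
    inverse of F, and its shape is read off there. *)

Section PadicArithmetic.
Variables (p : nat) (pp : prime p).
Local Notation Qp := (Qp pp).
Implicit Types (x y z a w : Qp) (n k : nat).

Lemma rp_gt0 : 0 < p%:R :> rat.
Proof. by rewrite ltr0n prime_gt0. Qed.

Lemma rp_gt1 : 1 < p%:R :> rat.
Proof. by rewrite ltr1n prime_gt1. Qed.

Lemma pnorm_gt0 x : (0 < pnorm x) = (x != 0).
Proof. by rewrite lt_neqAle pnorm_ge0 andbT eq_sym pnorm_eq0. Qed.

Lemma Qp_p_neq0 : p%:R != 0 :> Qp.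
Proof. by rewrite -pnorm_eq0 pnorm_p invr_eq0 gt_eqF// rp_gt0. Qed.

Lemma pnormXp n : pnorm (p%:R ^+ n : Qp) = p%:R ^- n.
Proof. by rewrite pnormX pnorm_p exprVn. Qed.

Lemma Xp_neq0 n : p%:R ^+ n != 0 :> Qp.
Proof. by rewrite expf_neq0// Qp_p_neq0. Qed.

Lemma pnorm_distC x y : pnorm (x - y) = pnorm (y - x).
Proof. by rewrite -opprB pnormN. Qed.

Lemma pnorm_leD x y (r : rat) : pnorm x <= r -> pnorm y <= r -> pnorm (x + y) <= r.
Proof. by move=> xr yr; rewrite (le_trans (pnorm_ultra _ _))// ge_max xr. Qed.

Lemma pnorm_isosceles x y : pnorm (x - y) < pnorm y -> pnorm x = pnorm y.
Proof.
move=> xy; apply/le_anti/andP; split.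
  by rewrite -{1}(subrK y x) (le_trans (pnorm_ultra _ _))// ge_max lexx (ltW xy).
have := pnorm_ultra x (y - x); rewrite subrKC le_max => /orP[//|].
by rewrite pnorm_distC leNgt xy.
Qed.

Lemma pnorm_int (m : int) : pnorm (m%:~R : Qp) <= 1.
Proof.
rewrite -[m%:~R]ratr_int pnorm_ratr -[m%:~R]divr1 -[1]/(1%:~R) qnormE//.
rewrite /znorm/= logn1 expr0 invr1 divr1; case: ifP => // _.
by rewrite invf_le1 ?exprn_gt0 ?rp_gt0// exprn_ege1// ltW// rp_gt1.
Qed.

Lemma pnorm_nat n : pnorm (n%:R : Qp) <= 1.
Proof. exact: (pnorm_int n%:Z). Qed.

Lemma pnorm_int_dvd (m : int) n : pnorm (m%:~R : Qp) <= p%:R ^- n ->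
  m != 0 -> (p ^ n %| `|m|)%N.
Proof.
rewrite -ratr_int pnorm_ratr -[m%:~R]divr1 -[1 in X in qnorm _ X]/(1%:~R) => + m0.
rewrite qnormE// /znorm (negbTE m0)/= logn1 expr0 invr1 divr1.
rewrite lef_pV2 ?posrE ?exprn_gt0 ?rp_gt0// ler_eXn2l ?rp_gt1// => nm.
by rewrite pfactor_dvdn ?absz_gt0.
Qed.

(** The norm is constant along the tail of a representing sequence of rationals, hence a power of p.
    Exponents are natural numbers, so both signs appear; arguments about all nonzero x then run over
    units, powers of p and their inverses. *)
Lemma pnorm_decomp x : x != 0 ->
  exists n u, pnorm u = 1 /\ (x = p%:R ^+ n * u \/ x = p%:R ^- n * u).
Proof.
move=> x0; have [N /(_ N (leqnn N))] := pnorm_evt x0.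
set q := (repr x : qseq pp) N => qx.
have q0 : q != 0 by rewrite -(qnorm_eq0 pp) qx pnorm_eq0.
have : exists n, pnorm x = p%:R ^- n \/ pnorm x = p%:R ^+ n.
  rewrite -qx /qnorm /znorm (negbTE (denq_neq0 _)) numq_eq0 (negbTE q0) invrK.
  set i := logn _ _; set j := logn _ _; have p0 := gt_eqF rp_gt0.
  case/orP: (leq_total i j) => ij.
    exists (j - i)%N; right; rewrite -{1}(subnK ij) exprD mulrCA mulVf ?mulr1//.
    by rewrite expf_neq0// p0.
  exists (i - j)%N; left; rewrite -{1}(subnK ij) exprD invfM -mulrA mulVf ?mulr1//.
  by rewrite expf_neq0// p0.
have pn0 n : p%:R ^+ n != 0 :> rat by rewrite expf_neq0// gt_eqF// rp_gt0.
move=> [n [xn|xn]]; exists n.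
- exists (p%:R ^- n * x); split; last by left; rewrite mulVKf// Xp_neq0.
  by rewrite pnormM pnormV pnormXp invrK xn divff.
- exists (p%:R ^+ n * x); split; last by right; rewrite mulKf// Xp_neq0.
  by rewrite pnormM pnormXp xn mulVf.
Qed.

Lemma pnorm_lt1 x : pnorm x < 1 -> pnorm x <= p%:R^-1.
Proof.
have [->|x0] := eqVneq x 0; first by rewrite pnorm0 invr_ge0 ler0n.
have [n [u [u1 [->|->]]]] := pnorm_decomp x0.
  rewrite pnormM u1 mulr1 pnormXp; case: n => [|n _].
    by rewrite expr0 invr1 ltxx.
  rewrite lef_pV2 ?posrE ?exprn_gt0 ?rp_gt0// exprS ler_peMr ?ler0n//.
  by rewrite exprn_ege1// ltW// rp_gt1.
rewrite pnormM u1 mulr1 pnormV pnormXp invrK ltNge.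
by rewrite exprn_ege1// ltW// rp_gt1.
Qed.

Lemma pnorm_ltM x w : pnorm x < pnorm w -> pnorm x <= pnorm (p%:R * w).
Proof.
have [->|w0] := eqVneq w 0; first by rewrite pnorm0 ltNge pnorm_ge0.
have wn0 : 0 < pnorm w by rewrite pnorm_gt0.
move=> xw; have := @pnorm_lt1 (x / w).
rewrite pnormM pnormV ltr_pdivrMr ?mul1r// ler_pdivrMr// => /(_ xw).
by rewrite pnormM pnorm_p.
Qed.

Lemma expp_unbounded (r : rat) : exists n, r < p%:R ^+ n.
Proof.
exists (Num.truncn r).+1; rewrite (lt_trans (truncnS_gt _))//.
by rewrite -natrX ltr_nat ltn_expl// prime_gt1.
Qed.

Lemma expp_small (e : rat) : 0 < e -> exists n, p%:R ^- n < e.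
Proof.
move=> e0; have [n ne] := expp_unbounded e^-1; exists n.
by rewrite -[e]invrK ltf_pV2 ?posrE ?invr_gt0 ?exprn_gt0 ?rp_gt0.
Qed.

Lemma expp_le m n : (m <= n)%N -> p%:R ^+ m <= p%:R ^+ n :> rat.
Proof. by move=> mn; rewrite ler_weXn2l// ltW// rp_gt1. Qed.

Lemma exppV_le m n : (m <= n)%N -> p%:R ^- n <= p%:R ^- m :> rat.
Proof. by move=> mn; rewrite lef_pV2 ?posrE ?exprn_gt0 ?rp_gt0// expp_le. Qed.

(** A rational q within p^-n of x has norm at most 1, so its denominator in lowest terms is prime to
    p. Bezout provides an inverse u of the denominator modulo p^n; the integer [numq q * u] is then
    congruent to q, and k is its residue. *)
Lemma Zp_approx x n : pnorm x <= 1 ->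
  exists2 k, (k < p ^ n)%N & pnorm (x - k%:R) <= p%:R ^- n.
Proof.
move=> x1; have pn0 : 0 < (p%:R ^- n : rat) by rewrite invr_gt0 exprn_gt0// rp_gt0.
have pn1 : (p%:R ^- n : rat) <= 1.
  by rewrite invf_le1 ?exprn_gt0 ?rp_gt0// exprn_ege1// ltW// rp_gt1.
have [q] := Qp_dense x pn0; rewrite /pdist => /ltW xq.
have q1 : pnorm (ratr q : Qp) <= 1.
  have -> : ratr q = x - (x - ratr q) :> Qp by ring.
  by rewrite pnorm_leD// pnormN (le_trans xq).
have pden : ~~ (p %| `|denq q|)%N.
  apply/negP => pd; have pnum : ~~ (p %| `|numq q|)%N.
    apply/negP => pn; have /eqP g := coprime_num_den q.
    have := dvdn_gcd p `|numq q| `|denq q|; rewrite pn pd g dvdn1.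
    by move: (prime_gt1 pp); case: (p) => [|[]].
  move: q1; rewrite pnorm_ratr /qnorm /znorm (negbTE (denq_neq0 _)) invrK.
  case: ifPn => [/eqP E|_]; first by move: pnum; rewrite E dvdn0.
  have -> : logn p `|numq q| = 0%N.
    by rewrite lognE; case: and3P => // -[_ _ h]; rewrite h in pnum.
  rewrite expr0 invr1 mul1r leNgt => /negP; apply.
  rewrite exprn_egt1 ?rp_gt1// -lt0n logn_gt0 mem_primes pp absz_gt0 denq_neq0 pd.
  by [].
have cop : coprime (p ^ n) `|denq q|.
  by rewrite coprimeXl// prime_coprime.
have nden : pnorm ((denq q)%:~R : Qp) = 1.
  rewrite -[_%:~R]ratr_int pnorm_ratr -[(denq q)%:~R]divr1 -[1 in X in qnorm _ X]/(1%:~R) qnormE//.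
  rewrite /znorm/= logn1 expr0 invr1 divr1 (negbTE (denq_neq0 _)) lognE.
  by rewrite (negbTE pden) !andbF expr0 invr1.
have [u [v uv]] : exists u v : int, u * denq q + v * (p ^ n)%N%:Z = 1.
  have [u [v]] := Bezoutz (denq q) (p ^ n)%N.
  rewrite /gcdz/= gcdnC (eqP cop) => uv; by exists u, v.
pose m := numq q * u; pose k := `|(m %% (p ^ n)%N%:Z)%Z|%N.
have pnz : (p ^ n)%N%:Z != 0 :> int.
  by rewrite -lt0n expn_gt0 prime_gt0.
exists k.
  rewrite -ltz_nat /k gez0_abs ?modz_ge0//.
  by rewrite ltz_pmod// ltz_nat expn_gt0 prime_gt0.
have -> : x - k%:R = (x - ratr q) + ((ratr q - m%:~R) + (m%:~R - k%:R)) by ring.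
apply: pnorm_leD => //; apply: pnorm_leD.
  have -> : ratr q - m%:~R = (numq q)%:~R * v%:~R / (denq q)%:~R * p%:R ^+ n :> Qp.
    rewrite /ratr; have d0 : (denq q)%:~R != 0 :> Qp.
      by rewrite -pnorm_eq0 nden oner_eq0.
    have := congr1 (fun i : int => i%:~R : Qp) uv.
    rewrite rmorphD/= !rmorphM/= -[((p ^ n)%N%:Z)%:~R]/((p ^ n)%N%:R) natrX => E.
    have {}E : v%:~R * p%:R ^+ n = 1 - u%:~R * (denq q)%:~R :> Qp.
      by apply/eqP; rewrite eq_sym subr_eq addrC E.
    transitivity ((numq q)%:~R * (v%:~R * p%:R ^+ n) / (denq q)%:~R : Qp); last by ring.
    by rewrite E mulrBr mulr1 mulrBl !mulrA mulfK.
  rewrite pnormM pnormXp.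
  apply: ler_piMl; first exact: ltW.
  rewrite pnormM pnormV.
  rewrite nden.
  rewrite invr1 mulr1.
  rewrite pnormM.
  by apply: mulr_ile1; rewrite ?pnorm_ge0 ?pnorm_int.
have -> : m%:~R - k%:R = ((m %/ (p ^ n)%N%:Z)%Z)%:~R * p%:R ^+ n :> Qp.
  rewrite {1}(divz_eq m (p ^ n)%N%:Z) rmorphD rmorphM/=.
  rewrite -[((p ^ n)%N%:Z)%:~R]/((p ^ n)%N%:R) natrX.
  have -> : k%:R = ((m %% (p ^ n)%N%:Z)%Z)%:~R :> Qp.
    by rewrite /k -[_%:R]/((Posz _)%:~R) gez0_abs ?modz_ge0.
  ring.
by rewrite pnormM pnormXp ler_piMl ?(ltW pn0)// pnorm_int.
Qed.


Lemma near_Qp (x : Qp) (P : set Qp) :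
  (\forall y \near x, P y) <-> exists n, forall y, pnorm (y - x) <= p%:R ^- n -> P y.
Proof.
split.
  move=> /nbhs_ballP[e /= e0 eP]; have [n ne] := expp_small e0.
  exists n => y yx; apply: eP; rewrite ballEmdist; change (pnorm (x - y) < e).
  by rewrite pnorm_distC (le_lt_trans yx).
move=> [n nP]; apply/nbhs_ballP; exists (p%:R ^- n) => /=.
  by rewrite invr_gt0 exprn_gt0// rp_gt0.
move=> y; rewrite ballEmdist => yx; apply: nP; rewrite pnorm_distC; exact: (ltW yx).
Qed.

(** For each m finitely many balls of radius p^-m cover the given ball, so an ultrafilter contains
    one of them. The chosen centres form a Cauchy sequence, and the ultrafilter converges to its
    limit. *)
Lemma compact_Qp_ball n : compact [set x : Qp | pnorm x <= p%:R ^+ n].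
Proof.
rewrite compact_ultra => F FU FB.
have cover m : exists c : Qp, F [set x | pnorm (x - c) <= p%:R ^- m].
  apply: contrapT => /forallNP Fc.
  have FN (c : Qp) : F [set x | ~ pnorm (x - c) <= p%:R ^- m].
    have [/Fc//|] := in_ultra_setVsetC [set x | pnorm (x - c) <= p%:R ^- m] FU.
    by [].
  have FA N : F [set x | forall k, (k < N)%N ->
      ~ pnorm (x - k%:R / p%:R ^+ n) <= p%:R ^- m].
    elim: N => [|N IH]; first by apply: filterS filterT => x _ k; rewrite ltn0.
    apply: filterS2 IH (FN (N%:R / p%:R ^+ n)) => x xN xN' k.
    by rewrite ltnS leq_eqVlt => /orP[/eqP->//|/xN].
  (* Multiplication by p^n brings x into Z_p. Approximating there by residues modulo p^(n+m) and
     dividing back loses a factor p^n, which leaves the radius p^-m. *)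
  have [x [/= xn xN]] := filter_ex (filterI FB (FA (p ^ (n + m))%N)).
  have [|k kN kx] := @Zp_approx (x * p%:R ^+ n) (n + m).
    by rewrite pnormM pnormXp ler_pdivrMr ?mul1r// exprn_gt0// rp_gt0.
  apply: (xN k kN); have -> : x - k%:R / p%:R ^+ n = (x * p%:R ^+ n - k%:R) / p%:R ^+ n.
    by rewrite mulrBl mulfK// Xp_neq0.
  rewrite pnormM pnormV pnormXp invrK -ler_pdivlMr ?exprn_gt0 ?rp_gt0//.
  by rewrite -invfM -exprD addnC.
have [c Fc] := choice cover.
have cc m m' : (m <= m')%N -> pnorm (c m' - c m) <= p%:R ^- m.
  move=> mm'; have [x [/= xm xm']] := filter_ex (filterI (Fc m) (Fc m')).
  have -> : c m' - c m = (x - c m) - (x - c m') by ring.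
  by rewrite pnorm_leD// pnormN (le_trans xm')// exppV_le.
have [e e0|l cl] := @Qp_complete p pp c.
  have [N Ne] := expp_small e0; exists N => i j Ni Nj.
  rewrite /pdist (le_lt_trans _ Ne)//.
  have -> : c i - c j = (c i - c N) - (c j - c N) by ring.
  by rewrite pnorm_leD// ?pnormN cc.
have Fl m : F [set x | pnorm (x - l) <= p%:R ^- m].
  have : \forall y \near l, pnorm (y - l) <= p%:R ^- m by apply/near_Qp; exists m.
  move=> /cl[N _ Nc]; have := Nc (maxn N m) (leq_maxl _ _) => /= cl'.
  apply: filterS (Fc (maxn N m)) => x /= xc.
  have -> : x - l = (x - c (maxn N m)) + (c (maxn N m) - l) by ring.
  by rewrite pnorm_leD// (le_trans xc)// exppV_le// leq_maxr.
exists l; split => /=.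
  have [x [/= xn xl]] := filter_ex (filterI FB (Fl 0%N)).
  have -> : l = x - (x - l) by ring.
  rewrite pnorm_leD// pnormN (le_trans xl)// expr0 invr1.
  by rewrite exprn_ege1// ltW// rp_gt1.
by move=> A /near_Qp[m mA]; apply: filterS (Fl m).
Qed.

End PadicArithmetic.

(** * The additive character *)

Section AdditiveCharacter.
Variables (R : realType) (p : nat) (pp : prime p).
Local Notation C := (Cplx R).
Local Notation Qp := (Qp pp).
Local Notation cis := (@cis R).

Lemma Qp_ratrB (x y : rat) : ratr (x - y) = ratr x - ratr y :> Qp.
Proof.
rewrite -!(Qp_of_ratE pp) /Qp_of_rat -rmorphB; apply/Qp_piE => e e0.
by exists 0%N => n _; rewrite subrr qnorm0.
Qed.

Lemma Qp_ratrM (x y : rat) : ratr (x * y) = ratr x * ratr y :> Qp.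
Proof.
rewrite -!(Qp_of_ratE pp) /Qp_of_rat -rmorphM; apply/Qp_piE => e e0.
by exists 0%N => n _; rewrite subrr qnorm0.
Qed.

Lemma Qp_ratrD (x y : rat) : ratr (x + y) = ratr x + ratr y :> Qp.
Proof. by apply/eqP; rewrite -subr_eq -Qp_ratrB addrK. Qed.

Lemma Qp_ratr_div (x y : rat) : y != 0 -> ratr (x / y) = ratr x / ratr y :> Qp.
Proof.
move=> y0; have ry0 : ratr y != 0 :> Qp by rewrite -pnorm_eq0 pnorm_ratr qnorm_eq0.
by apply: (mulIf ry0); rewrite -Qp_ratrM !divfK.
Qed.

Lemma cisD (x y : R) : cis (x + y) = cis x * cis y.
Proof.
rewrite /Defs.cis cosD sinD; apply/eqP; rewrite eq_complex /=.
by rewrite eqxx/= addrC eqxx.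
Qed.

Lemma cis0 : cis 0 = 1.
Proof. by rewrite /Defs.cis cos0 sin0. Qed.

Lemma cis_int (m : int) : cis (2 * pi * m%:~R) = 1.
Proof.
have cis_nat n : cis (2 * pi * n%:R) = 1.
  elim: n => [|n IH]; first by rewrite mulr0 cis0.
  rewrite -(natr1 n) mulrDr cisD IH mul1r mulr1 mulr_natl /Defs.cis cos2pi sin2pi.
  by [].
case: m => n; first exact: cis_nat.
have := cis_nat n.+1; rewrite NegzE mulrNz mulrN => E.
have := cisD (2 * pi * n.+1%:R) (- (2 * pi * n.+1%:R)).
by rewrite subrr cis0 E mul1r => <-.
Qed.

(** Z[1/p] meets Z_p in Z: the source of the uniqueness of the fractional part modulo 1. *)
Lemma rat_int_of_qnorm (r : rat) n : r * p%:R ^+ n \is a Num.int ->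
  qnorm p r <= 1 -> r \is a Num.int.
Proof.
move=> /intrP[a ra] r1; have pn0 : p%:R ^+ n != 0 :> rat.
  by rewrite expf_neq0// gt_eqF// rp_gt0.
have rE : r = a%:~R / p%:R ^+ n by rewrite -ra mulfK.
have [a0|a0] := eqVneq a 0; first by rewrite rE a0 mul0r.
have : pnorm (a%:~R : Qp) <= p%:R ^- n.
  have pnE : qnorm p (p%:R ^+ n) = p%:R ^- n.
    by rewrite -(pnormXp pp) -!natrX -(ratr_nat Qp) pnorm_ratr.
  rewrite -ratr_int pnorm_ratr -ra qnormM// pnE ler_piMl// invr_ge0 exprn_ge0// ler0n.
move=> /pnorm_int_dvd /(_ a0) pa.
have /dvdzP[b ab] : ((p ^ n)%N%:Z %| a)%Z by rewrite /dvdz/= unfold_in.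
by rewrite rE ab rmorphM/= -[((p ^ n)%N%:Z)%:~R]/((p ^ n)%N%:R) natrX mulfK.
Qed.

Lemma frac_partP (x : Qp) : [/\ 0 <= frac_part x < 1,
  exists n, frac_part x * p%:R ^+ n \is a Num.int
  & pnorm (x - ratr (frac_part x)) <= 1].
Proof.
rewrite /frac_part.
suff [q qx] : exists q : rat, [/\ 0 <= q < 1, exists n, q * p%:R ^+ n \is a Num.int
    & pnorm (x - ratr q) <= 1] by exact: (xgetPex 0 (ex_intro (fun q : rat => [/\ 0 <= q < 1,
      exists n, q * p%:R ^+ n \is a Num.int & pnorm (x - ratr q) <= 1]) q qx)).
have [n xn] := expp_unbounded pp (pnorm x).
have pn0 : 0 < p%:R ^+ n :> rat by rewrite exprn_gt0// rp_gt0.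
have [|k kn xk] := @Zp_approx p pp (x * p%:R ^+ n) n.
  by rewrite pnormM pnormXp ler_pdivrMr// mul1r ltW.
exists (k%:R / p%:R ^+ n); split.
- rewrite divr_ge0 ?exprn_ge0 ?ler0n//= ltr_pdivrMr// mul1r -natrX ltr_nat.
  exact: kn.
- exists n; rewrite mulfVK ?gt_eqF//.
- rewrite Qp_ratr_div; last by rewrite expf_neq0// gt_eqF// rp_gt0.
  rewrite -natrX !ratr_nat natrX.
  have -> : x - k%:R / p%:R ^+ n = (x * p%:R ^+ n - k%:R) / p%:R ^+ n.
    by rewrite mulrBl mulfK// Xp_neq0.
  rewrite pnormM pnormV pnormXp invrK -ler_pdivlMr//.
  by rewrite mul1r.
Qed.

(** Any representative of x modulo Z_p in Z[1/p] may replace the fractional part, with no constraint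
    to [0, 1[. A sum of fractional parts is such a representative, which yields additivity at
    once. *)
Lemma chiE (x : Qp) (q : rat) n : q * p%:R ^+ n \is a Num.int ->
  pnorm (x - ratr q) <= 1 -> chi R x = cis (2 * pi * ratr q).
Proof.
move=> qn xq; have [_ [m fm] fx] := frac_partP x.
have : frac_part x - q \is a Num.int.
  apply: (@rat_int_of_qnorm _ (m + n)).
    have -> : (frac_part x - q) * p%:R ^+ (m + n) =
      (frac_part x * p%:R ^+ m) * (p ^ n)%N%:R - (q * p%:R ^+ n) * (p ^ m)%N%:R.
      by rewrite !natrX exprD; ring.
    by rewrite rpredB// rpredM// natr_int.
  rewrite -(pnorm_ratr pp) Qp_ratrB.
  have -> : ratr (frac_part x) - ratr q = (x - ratr q) - (x - ratr (frac_part x)) by ring.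
  by apply: pnorm_leD; rewrite ?pnormN.
move=> /intrP[a fa]; rewrite /chi -[frac_part x](subrK q) fa rmorphD/= ratr_int.
by rewrite mulrDr cisD cis_int mul1r.
Qed.

Lemma chiD (x y : Qp) : chi R (x + y) = chi R x * chi R y.
Proof.
have [_ [m xm] x1] := frac_partP x; have [_ [n yn] y1] := frac_partP y.
rewrite (@chiE (x + y) (frac_part x + frac_part y) (m + n)).
- by rewrite rmorphD/= mulrDr cisD.
- have -> : (frac_part x + frac_part y) * p%:R ^+ (m + n) =
    (frac_part x * p%:R ^+ m) * (p ^ n)%N%:R + (frac_part y * p%:R ^+ n) * (p ^ m)%N%:R.
    by rewrite !natrX exprD; ring.
  by rewrite rpredD// rpredM// natr_int.
have -> : x + y - ratr (frac_part x + frac_part y) =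
  (x - ratr (frac_part x)) + (y - ratr (frac_part y)) by rewrite Qp_ratrD opprD addrACA.
by apply: pnorm_leD.
Qed.

Lemma chi_Zp (x : Qp) : pnorm x <= 1 -> chi R x = 1.
Proof.
move=> x1; rewrite (@chiE x 0 0) ?mul0r ?rpred0//.
  by rewrite raddf0 mulr0 cis0.
by rewrite (ratr_nat _ 0) subr0.
Qed.

Lemma cos_lt1 (x : R) : 0 < x <= pi -> cos x < 1.
Proof.
move=> /andP[x0 xp]; rewrite -cos0 ltr_cos ?in_itv/= ?lexx ?pi_ge0//.
by rewrite (ltW x0).
Qed.

(** Since p >= 2, the angle 2 pi / p lies in ]0, pi], where the cosine is below 1. This
    nontriviality of chi makes its integrals over large balls vanish. *)
Lemma chi_pV : chi R (p%:R^-1 : Qp) != 1.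
Proof.
rewrite (@chiE _ p%:R^-1 1).
- have : cos (2 * pi * ratr p%:R^-1 : R) < 1.
    apply: cos_lt1; rewrite fmorphV/= ratr_nat.
    have p2 : (2 : R) <= p%:R by rewrite ler_nat prime_gt1.
    have p0 : (0 : R) < p%:R by rewrite ltr0n prime_gt0.
    rewrite !mulr_gt0 ?pi_gt0 ?invr_gt0//= ler_pdivrMr// mulrC.
    by rewrite ler_pM2l// pi_gt0.
  by apply: contraTneq => -[-> _]; rewrite ltxx.
- by rewrite expr1 mulVf ?rpred1// gt_eqF// rp_gt0.
- rewrite -(div1r (p%:R : rat)) Qp_ratr_div ?gt_eqF ?rp_gt0//.
  by rewrite (ratr_nat _ 1) ratr_nat div1r subrr pnorm0.
Qed.

End AdditiveCharacter.

(** * Test functions *)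

Section TestFunctions.
Variables (R : realType) (p : nat) (pp : prime p).
Local Notation C := (Cplx R).
Local Notation Qp := (Qp pp).
Implicit Types (phi psi : Qp -> C) (x y a w z : Qp).

(* The radius of the ball is |w|, so that dilations act by multiplication on
   both parameters. *)
Definition bfun a w x : C := if pnorm (x - a) <= pnorm w then 1 else 0.

(** One number bounds both the fineness p^-n of phi and the radius p^n of its support, so that two
    test functions are brought to a common level by a maximum. *)
Definition uniform_level n phi :=
  (forall x y, pnorm y <= p%:R ^- n -> phi (x + y) = phi x) /\
  (forall x, phi x != 0 -> pnorm x <= p%:R ^+ n).

Lemma uniform_levelW m n phi : (m <= n)%N -> uniform_level m phi -> uniform_level n phi.
Proof.
move=> mn [p1 p2]; split=> [x y yn|x /p2 xm].
  by apply: p1; rewrite (le_trans yn)// exppV_le.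
by rewrite (le_trans xm)// expp_le.
Qed.

Lemma closed_Qp_ball n : closed [set x : Qp | pnorm x <= p%:R ^+ n].
Proof.
move=> x xn /=.
have : \forall y \near x, pnorm (y - x) <= 1.
  by apply/near_Qp; exists 0%N => y; rewrite expr0 invr1.
move=> /xn[y [/= yn yx]]; have -> : x = y - (y - x) by ring.
by rewrite pnorm_leD// pnormN (le_trans yx)// exprn_ege1// ltW// rp_gt1.
Qed.

(** Compactness of the support, in its near-covering form, turns the local radii of constancy into a
    single one. *)
Lemma testfunP phi : testfun phi <-> exists n, uniform_level n phi.
Proof.
split=> [[lc cp]|[n [p1 p2]]]; last first.
  split=> [x|]; first by apply/near_Qp; exists n => y yx; rewrite -(p1 x _ yx) [x + _]addrC subrK.
  apply: (subclosed_compact _ (compact_Qp_ball (pp := pp) (n := n))).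
    exact: closed_closure.
  have /closure_id-> := @closed_Qp_ball n.
  by apply: closure_subset => x /p2.
set K := closure _ in cp.
have [|N _ HN] := (compact_near_coveringP K).1 cp nat \oo
    (fun n x => (forall y, pnorm y <= p%:R ^- n -> phi (x + y) = phi x) /\
      pnorm x <= p%:R ^+ n) _.
  move=> x Kx; have /near_Qp[m mx] := lc x; have [k kx] := expp_unbounded pp (pnorm x).
  exists ([set y | pnorm (y - x) <= p%:R ^- m], [set n | (maxn m k <= n)%N]) => /=.
    split; last by exists (maxn m k).
    by apply/near_Qp; exists m.
  case=> y n [/= yx]; rewrite geq_max => /andP[mn kn]; split.
    move=> u un; rewrite (mx y yx) mx//.
    have -> : y + u - x = (y - x) + u by ring.
    by rewrite pnorm_leD// (le_trans un)// exppV_le.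
  have -> : y = (y - x) + x by ring.
  rewrite pnorm_leD//; last by rewrite (le_trans (ltW kx))// expp_le.
  rewrite (le_trans yx)// (@le_trans _ _ 1)//.
    by rewrite invf_le1 ?exprn_gt0 ?rp_gt0// exprn_ege1// ltW// rp_gt1.
  by rewrite exprn_ege1// ltW// rp_gt1.
have HK := HN N (leqnn N); exists N.
have sK x : phi x != 0 -> K x by move=> x0; apply: subset_closure.
split=> [x y yN|x /sK /HK[]//].
(* Uniformity is known on the support only. If phi vanishes at x but not at x + y, then x + y is in
   the support, and translating it by -y gives a contradiction. *)
have [/eqP x0|/sK/HK[->//]] := boolP (phi x == 0).
rewrite x0; apply/eqP; apply: contraT => /[dup] xy0 /sK/HK[/(_ (- y)) + _].
by rewrite pnormN addrK x0 => /(_ yN) /esym/eqP; rewrite (negbTE xy0).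
Qed.

Lemma testfun_lin (c : C) phi psi : testfun phi -> testfun psi ->
  testfun (fun x => c * phi x + psi x).
Proof.
move=> /testfunP[m fm] /testfunP[n gn]; apply/testfunP; exists (maxn m n).
have [f1 f2] := uniform_levelW (leq_maxl m n) fm.
have [g1 g2] := uniform_levelW (leq_maxr m n) gn.
split=> [x y yl|x]; first by rewrite f1// g1.
have [f0|/f2//] := eqVneq (phi x) 0.
by rewrite f0 mulr0 add0r => /g2.
Qed.

Lemma testfun0 : testfun (fun=> 0 : C) (pp := pp).
Proof. by apply/testfunP; exists 0%N; split=> // x; rewrite eqxx. Qed.

(** Local constancy of g is asked only where phi does not vanish, so g may be a multiplicative
    character, singular at 0, when phi(0) = 0. *)
Lemma testfunM (g : Qp -> C) phi : testfun phi ->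
  (forall x, phi x != 0 -> \forall y \near x, g y = g x) ->
  testfun (fun x => g x * phi x).
Proof.
move=> [lc cp] lg; split=> [x|].
  have [x0|x0] := eqVneq (phi x) 0.
    by apply: filterS (lc x) => y ->; rewrite x0 !mulr0.
  by apply: filterS2 (lc x) (lg x x0) => y -> ->.
apply: (subclosed_compact _ cp); first exact: closed_closure.
apply: closure_subset => x /=; apply: contra => /eqP->.
by rewrite mulr0.
Qed.

Lemma testfun_scale z phi : z != 0 -> testfun phi -> testfun (fun x => phi (z * x)).
Proof.
move=> z0 /testfunP[n fn]; apply/testfunP.
have [k kz] := expp_unbounded pp (pnorm z).
have [l lz] := expp_unbounded pp (pnorm z)^-1.
have nz : 0 < pnorm z by rewrite pnorm_gt0.
have pn0 m : 0 < p%:R ^+ m :> rat by rewrite exprn_gt0// rp_gt0.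
exists (n + maxn k l)%N; case: fn => f1 f2; split=> [x y yn|x /f2].
  rewrite mulrDr f1// pnormM.
  rewrite (le_trans (ler_wpM2l (ltW nz) yn))//.
  rewrite exprD invfM mulrCA ler_piMr ?invr_ge0 ?(ltW (pn0 _))//.
  by rewrite ler_pdivrMr// mul1r (le_trans (ltW kz))// expp_le// leq_maxl.
rewrite pnormM mulrC -ler_pdivlMr// => /le_trans; apply.
by rewrite exprD ler_pM2l// (le_trans (ltW lz))// expp_le// leq_maxr.
Qed.

Lemma testfun_div z phi : z != 0 -> testfun phi -> testfun (fun x => phi (x / z)).
Proof.
move=> z0 /(@testfun_scale z^-1 _ _); rewrite invr_eq0 => /(_ z0).
by under [X in testfun X -> _]funext do rewrite mulrC.
Qed.

Lemma bfun_eq a w x y : pnorm (x - y) <= pnorm w -> bfun a w x = bfun a w y.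
Proof.
move=> xy; rewrite /bfun; suff -> : (pnorm (x - a) <= pnorm w) = (pnorm (y - a) <= pnorm w) by [].
apply/idP/idP => h.
  have -> : y - a = (x - a) - (x - y) by ring.
  by rewrite pnorm_leD// pnormN.
have -> : x - a = (y - a) + (x - y) by ring.
by rewrite pnorm_leD.
Qed.

Lemma testfun_bfun a w : w != 0 -> testfun (bfun a w).
Proof.
move=> w0; apply/testfunP.
have nw : 0 < pnorm w by rewrite pnorm_gt0.
have [k kw] := expp_small pp nw.
have [l lw] := expp_unbounded pp (pnorm w).
have [m ma] := expp_unbounded pp (pnorm a).
exists (maxn k (maxn l m)); split=> [x y yn|x].
  apply: bfun_eq; rewrite addrC addKr (le_trans yn)// (le_trans _ (ltW kw))//.
  by rewrite exppV_le// leq_maxl.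
rewrite /bfun; case: ifP => [xa _|]; last by rewrite eqxx.
have -> : x = (x - a) + a by ring.
rewrite pnorm_leD//.
  rewrite (le_trans xa)// (le_trans (ltW lw))// expp_le//.
  by rewrite (leq_trans (leq_maxl l m))// leq_maxr.
by rewrite (le_trans (ltW ma))// expp_le// (leq_trans (leq_maxr l m))// leq_maxr.
Qed.

Lemma bfun_scale a w z x : z != 0 -> bfun a w (x / z) = bfun (z * a) (z * w) x.
Proof.
move=> z0; rewrite /bfun.
have -> : x - z * a = z * (x / z - a) by rewrite mulrBr mulrCA divff// mulr1.
by rewrite !pnormM ler_pM2l// pnorm_gt0.
Qed.

Lemma bfun_radius a w w' : pnorm w = pnorm w' -> bfun a w = bfun a w'.
Proof. by move=> ww; apply/funext => x; rewrite /bfun ww. Qed.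

(** The index k is the residue of (x - a) / w modulo p^n. The Boolean equation carries existence and
    uniqueness together, and so serves both to split indicators and to prove the subballs
    disjoint. *)
Lemma ball_partition a w x n : w != 0 -> pnorm (x - a) <= pnorm w ->
  exists k : 'I_(p ^ n), forall j : 'I_(p ^ n),
    (pnorm (x - (a + j%:R * w)) <= pnorm (p%:R ^+ n * w)) = (j == k).
Proof.
move=> w0 xa; have nw : 0 < pnorm w by rewrite pnorm_gt0.
have [|k kn xk] := @Zp_approx p pp ((x - a) / w) n.
  by rewrite pnormM pnormV ler_pdivrMr// mul1r.
exists (Ordinal kn) => j.
have -> : x - (a + j%:R * w) = ((x - a) / w - j%:R) * w.
  by rewrite mulrBl divfK// opprD addrA.
rewrite !pnormM ler_pM2r// pnormXp; apply/idP/eqP => [xj|->//].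
have jk : pnorm ((j%:Z - k%:Z)%:~R : Qp) <= p%:R ^- n.
  have -> : (j%:Z - k%:Z)%:~R = ((x - a) / w - k%:R) - ((x - a) / w - j%:R) :> Qp.
    rewrite rmorphB/= -[(j%:Z)%:~R]/(j%:R) -[(k%:Z)%:~R]/(k%:R); ring.
  by rewrite pnorm_leD// pnormN.
apply: val_inj => /=; apply/eqP; apply: contraT => njk.
have jk0 : j%:Z - k%:Z != 0 by rewrite subr_eq0.
have := pnorm_int_dvd jk jk0; move=> /dvdn_leq; rewrite absz_gt0 => /(_ jk0).
by move: (ltn_ord j); lia.
Qed.

Lemma ball_sub a w x n k : w != 0 ->
  pnorm (x - (a + k%:R * w)) <= pnorm (p%:R ^+ n * w) -> pnorm (x - a) <= pnorm w.
Proof.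
move=> w0 xk; have nw : 0 < pnorm w by rewrite pnorm_gt0.
have -> : x - a = (x - (a + k%:R * w)) + k%:R * w by ring.
rewrite pnorm_leD//.
  rewrite (le_trans xk)// pnormM ler_piMl ?(ltW nw)// pnormXp.
  by rewrite invf_le1 ?exprn_gt0 ?rp_gt0// exprn_ege1// ltW// rp_gt1.
by rewrite pnormM ler_piMl ?(ltW nw)// pnorm_nat.
Qed.

Lemma bfun_split a w n x : w != 0 ->
  bfun a w x = \sum_(k < p ^ n) bfun (a + k%:R * w) (p%:R ^+ n * w) x.
Proof.
move=> w0; rewrite {1}/bfun; case: ifPn => [xa|].
  have [k kP] := ball_partition n w0 xa.
  rewrite (bigD1 k)//= /bfun kP eqxx big1 ?addr0// => j jk.
  by rewrite kP (negbTE jk).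
rewrite -ltNge => xa; rewrite big1// => k _; rewrite /bfun ifF//.
apply/negbTE; rewrite -ltNge; move: xa; rewrite !ltNge; apply: contra.
exact: ball_sub.
Qed.

(** Note that w = p^-n has norm p^n. The ball of that radius contains the support, and cutting it
    into p^(2n) pieces gives balls of radius p^-n, on which phi is constant. *)
Lemma level_expand n phi : uniform_level n phi -> let w := p%:R ^- n : Qp in
  phi = fun x => \sum_(k < p ^ (n + n)) phi (k%:R * w) * bfun (k%:R * w) (p%:R ^+ n) x.
Proof.
move=> [f1 f2] w; have w0 : w != 0 by rewrite invr_eq0 Xp_neq0.
have wE : p%:R ^+ (n + n) * w = p%:R ^+ n by rewrite exprD mulfK// Xp_neq0.
apply/funext => x; transitivity (phi x * bfun 0 w x).
  rewrite /bfun subr0; case: ifPn; first by rewrite mulr1.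
  rewrite mulr0 pnormV pnormXp invrK => xn; apply/eqP.
  by apply: contraNT xn; exact: f2.
rewrite (bfun_split _ (n + n) _ w0) mulr_sumr; apply: eq_bigr => k _.
rewrite add0r wE /bfun; case: ifP => [|_]; last by rewrite !mulr0.
rewrite pnormXp => xk; rewrite -(f1 (k%:R * w) (x - k%:R * w) xk).
by rewrite addrC subrK.
Qed.

Lemma is_distribution0 (G : functional R pp) : is_distribution G -> G (fun=> 0) = 0.
Proof.
move=> /(_ 1 _ _ testfun0 testfun0).
rewrite mulr0 addr0.
by move=> /eqP; rewrite mul1r -subr_eq subrr eq_sym => /eqP.
Qed.

Lemma is_distribution_sum (G : functional R pp) n (c : nat -> C) (f : nat -> Qp -> C) :
  is_distribution G -> (forall i, testfun (f i)) ->
  testfun (fun x => \sum_(i < n) c i * f i x) /\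
  G (fun x => \sum_(i < n) c i * f i x) = \sum_(i < n) c i * G (f i).
Proof.
move=> dG tf; elim: n => [|n [IH1 IH2]].
  have -> : (fun x => \sum_(i < 0) c i * f i x) = fun=> 0.
    by apply/funext => x; rewrite big_ord0.
  by rewrite big_ord0 is_distribution0//; split=> //; exact: testfun0.
have -> : (fun x => \sum_(i < n.+1) c i * f i x) =
  (fun x => c n * f n x + \sum_(i < n) c i * f i x).
  by apply/funext => x; rewrite big_ord_recr/= addrC.
by rewrite dG// IH2 big_ord_recr/= addrC; split=> //; exact: testfun_lin.
Qed.

(** The basic reduction to balls. Centres are restricted to points where phi does not vanish: for
    phi(0) = 0 this keeps small balls away from 0, where characters are locally constant. *)
Lemma dist_eq_balls (G H : functional R pp) phi :
  is_distribution G -> is_distribution H -> testfun phi ->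
  (exists N, forall n a, (N <= n)%N -> phi a != 0 ->
    G (bfun a (p%:R ^+ n)) = H (bfun a (p%:R ^+ n))) ->
  G phi = H phi.
Proof.
move=> dG dH /testfunP[m fm] [N GH].
have fn := uniform_levelW (leq_maxl m N) fm; set n := maxn m N in fn.
have := level_expand fn; set w := p%:R ^- n => /= fE.
have tb i : testfun (bfun (i%:R * w) (p%:R ^+ n)) by apply: testfun_bfun; exact: Xp_neq0.
have S G' (dG' : is_distribution G') : G' phi =
    \sum_(k < p ^ (n + n)) phi (k%:R * w) * G' (bfun (k%:R * w) (p%:R ^+ n)).
  rewrite {1}fE; exact: (is_distribution_sum (p ^ (n + n))
    (fun k => phi (k%:R * w)) dG' tb).2.
rewrite (S G)// (S H)//; apply: eq_bigr => k _.
have [->|k0] := eqVneq (phi (k%:R * w)) 0; first by rewrite !mul0r.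
by rewrite GH// leq_maxr.
Qed.

End TestFunctions.

(** * Integration of test functions *)

Section Integration.
Variables (R : realType) (p : nat) (pp : prime p).
Variable mu : {measure set (Qp_borel pp) -> \bar R}.
Hypothesis mu_haar : normalized_haar mu.
Local Notation C := (Cplx R).
Local Notation Qp := (Qp pp).
Implicit Types (phi psi : Qp -> C) (x y a w z : Qp).

Lemma normR_gt0 z : z != 0 -> 0 < normR R z.
Proof. by move=> z0; rewrite /normR ltr0q pnorm_gt0. Qed.

Lemma normRM x y : normR R (x * y) = normR R x * normR R y.
Proof. by rewrite /normR pnormM rmorphM. Qed.

Lemma normRV x : normR R x^-1 = (normR R x)^-1.
Proof. by rewrite /normR pnormV fmorphV. Qed.

Lemma normR1 : normR R (1 : Qp) = 1.
Proof. by rewrite /normR pnorm1 rmorph1. Qed.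

Lemma normRC_neq0 z : z != 0 -> (normR R z)%:C%C != 0 :> C.
Proof. by move=> z0; rewrite fmorph_eq0 gt_eqF// normR_gt0. Qed.

Lemma normRXp n : normR R (p%:R ^+ n : Qp) = p%:R ^- n.
Proof. by rewrite /normR pnormXp fmorphV rmorphXn/= ratr_nat. Qed.

Definition pball a w : set (Qp_borel pp) := [set x : Qp | pnorm (x - a) <= pnorm w].

Lemma measurable_pball a w : w != 0 -> measurable (pball a w).
Proof.
move=> w0; apply: sub_sigma_algebra => /=.
rewrite openE => x /= xa; rewrite /interior; apply/near_Qp.
have nw : 0 < pnorm w by rewrite pnorm_gt0.
have [k kw] := expp_small pp nw; exists k => y yx.
change (pnorm (y - a) <= pnorm w).
have -> : y - a = (y - x) + (x - a) by ring.
by rewrite pnorm_leD// (le_trans yx)// ltW.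
Qed.

Lemma mu_pball_shift a w : w != 0 -> mu (pball a w) = mu (pball 0 w).
Proof.
move=> w0; rewrite -[RHS](mu_haar.1 a); last exact: measurable_pball.
congr (mu _); apply/seteqP; split=> x /=.
  by move=> xa; exists (x - a); rewrite /pball/= ?subr0// addrC subrK.
by move=> [y + <-]; rewrite /pball/= subr0 [a + y]addrC addrK.
Qed.

Lemma mu_pball_split n w : w != 0 ->
  mu (pball 0 w) = ((p ^ n)%:R%:E * mu (pball 0%R (p%:R ^+ n * w)%R))%E.
Proof.
move=> w0; have pw0 : p%:R ^+ n * w != 0 by rewrite mulf_neq0// Xp_neq0.
pose F (k : nat) := pball (0 + k%:R * w) (p%:R ^+ n * w).
have -> : pball 0 w = \big[setU/set0]_(k < p ^ n) F k.
  rewrite -bigcup_mkord; apply/seteqP; split=> x.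
    move=> xw; have [k kP] := ball_partition n w0 xw; exists k => //=.
    by rewrite /F /pball/= kP.
  by move=> [k _ xk]; apply: ball_sub xk.
rewrite measure_bigsetU_ord; last 2 first.
- by move=> k; exact: measurable_pball.
- move=> i j _ _ [x [xi xj]].
  have [k kP] := ball_partition n w0 (ball_sub w0 xi).
  by move: xi xj; rewrite /F /pball/= !kP => /eqP-> /eqP->.
transitivity (\sum_(k < p ^ n) mu (pball 0%R (p%:R ^+ n * w)%R))%E.
  by apply: eq_bigr => k _; exact: mu_pball_shift.
by rewrite sumr_const card_ord mule_natl.
Qed.

(** For |w| = p^-n the unit ball is cut into p^n translates of the ball of radius |w|; for |w| = p^n
    the ball of radius |w| is cut into p^n translates of the unit ball. *)
Lemma mu_pball a w : w != 0 -> mu (pball a w) = (normR R w)%:E.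
Proof.
move=> w0; rewrite mu_pball_shift//.
have mu1 : mu (pball 0 1) = 1%E.
  rewrite -mu_haar.2; congr (mu _); apply/seteqP; split=> x;
  by rewrite /pball /Qp_ball0/= subr0 pnorm1.
have pn0 n : (p ^ n)%:R != 0 :> R.
  by rewrite pnatr_eq0 -lt0n expn_gt0 prime_gt0.
have pballr x y : pnorm x = pnorm y -> pball 0 x = pball 0 y.
  by move=> xy; rewrite /pball xy.
have [n [u [u1 [->|->]]]] := pnorm_decomp w0.
- rewrite (@pballr _ (p%:R ^+ n * 1)); last by rewrite !pnormM u1 pnorm1.
  have := mu_pball_split n (oner_neq0 Qp); rewrite mu1 mulr1 => E.
  rewrite normRM /normR u1 rmorph1 mulr1 pnormXp fmorphV rmorphXn/= ratr_nat.
  rewrite -[LHS]mul1e -[1%E](_ : (p%:R ^- n)%:E * (p ^ n)%:R%:E = 1)%E; last first.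
    by rewrite -EFinM natrX mulVf// -natrX.
  by rewrite -muleA -E mule1.
- rewrite (@pballr _ (p%:R ^- n)); last by rewrite !pnormM u1 mulr1.
  have := @mu_pball_split n (p%:R ^- n); rewrite invr_eq0 Xp_neq0 => /(_ isT) ->.
  rewrite mulfV ?Xp_neq0// mu1 mule1 normRM /normR u1 rmorph1 mulr1.
  by rewrite natrX pnormV pnormXp invrK [in RHS]rmorphXn/= ratr_nat.
Qed.

Definition cintegrable (f : Qp -> C) :=
  mu.-integrable setT (EFin \o (fun x : Qp_borel pp => complex.Re (f x))) /\
  mu.-integrable setT (EFin \o (fun x : Qp_borel pp => complex.Im (f x))).

Lemma cintegrable_lin (c : C) f g : cintegrable f -> cintegrable g ->
  cintegrable (fun x => c * f x + g x) /\
  cintegral mu setT (fun x => c * f x + g x) = c * cintegral mu setT f + cintegral mu setT g.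
Proof.
move=> [fr fi] [gr gi]; case: c => cr ci.
pose fR x := complex.Re (f x); pose fI x := complex.Im (f x).
pose gR x := complex.Re (g x); pose gI x := complex.Im (g x).
have iZ (k : R) (h : Qp_borel pp -> R) : mu.-integrable setT (EFin \o h) ->
    mu.-integrable setT (EFin \o (fun x => k * h x)).
  by move=> hi; have := integrableZl measurableT k hi.
have iD (h k : Qp_borel pp -> R) : mu.-integrable setT (EFin \o h) ->
    mu.-integrable setT (EFin \o k) ->
    mu.-integrable setT (EFin \o (fun x => h x + k x)).
  by move=> hi ki; have := integrableD measurableT hi ki.
have RE : (fun x => complex.Re ((cr +i* ci)%C * f x + g x)) =
    (fun x => cr * fR x + ((- ci) * fI x + gR x)).
  apply/funext => x; rewrite /fR /fI /gR; case: (f x) (g x) => [a b] [c d] /=.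
  ring.
have IE : (fun x => complex.Im ((cr +i* ci)%C * f x + g x)) =
    (fun x => cr * fI x + (ci * fR x + gI x)).
  apply/funext => x; rewrite /fR /fI /gI; case: (f x) (g x) => [a b] [c d] /=.
  ring.
split.
  by split; rewrite ?RE ?IE; apply: (iD) => //; [exact: iZ|apply: iD => //; exact: iZ|
    exact: iZ|apply: iD => //; exact: iZ].
rewrite /cintegral RE IE.
rewrite !RintegralD ?RintegralZl//; try (apply: iZ => //); try (apply: iD => //; exact: iZ).
apply/eqP; rewrite eq_complex/=; apply/andP; split; apply/eqP; ring.
Qed.

Lemma cintegrable_bfun a w : w != 0 -> cintegrable (bfun R a w) /\
  cintegral mu setT (bfun R a w) = (normR R w)%:C%C.
Proof.
move=> w0; have mB := measurable_pball a w0.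
have RE : (fun x : Qp_borel pp => complex.Re (bfun R a w x)) = \1_(pball a w).
  apply/funext => x; rewrite indicE /bfun; case: ifPn => xa; first by rewrite mem_set.
  by rewrite memNset//; exact/negP.
have IE : (fun x : Qp_borel pp => complex.Im (bfun R a w x)) = cst 0.
  by apply/funext => x; rewrite /bfun; case: ifP.
split.
  split; last by rewrite IE; exact: integrable0.
  rewrite RE; apply/integrableP; split.
    by apply/measurable_EFinP; exact: measurable_indic.
  rewrite (eq_integral (fun x : Qp_borel pp => (\1_(pball a w) x)%:E)); last first.
    by move=> x _ /=; rewrite ger0_norm.
  by rewrite integral_indic// setIT mu_pball// ltry.
rewrite /cintegral RE IE Rintegral_cst// mul0r; congr (_ +i* _)%C.
by rewrite /Rintegral integral_indic// setIT mu_pball.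
Qed.

Lemma cintegrable_testfun phi : testfun phi -> cintegrable phi.
Proof.
move=> /testfunP[n /level_expand/=]; set w := p%:R ^- n => ->.
have c0 : cintegrable (fun=> 0).
  by split; exact: integrable0.
have sumE N : cintegrable (fun x => \sum_(k < N) phi (k%:R * w) * bfun R (k%:R * w) (p%:R ^+ n) x).
  elim: N => [|N IH].
    by under [X in cintegrable X]funext do rewrite big_ord0.
  under [X in cintegrable X]funext do rewrite big_ord_recr/= addrC.
  apply: (cintegrable_lin _ _ IH).1.
  by apply: (cintegrable_bfun _ _).1; exact: Xp_neq0.
exact: sumE.
Qed.

Lemma is_distribution_cintegral : is_distribution (cintegral mu setT).
Proof.
by move=> c phi psi tphi tpsi; apply: (cintegrable_lin _ _ _).2; exact: cintegrable_testfun.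
Qed.

Lemma cintegral_mkcond (D : set Qp) f :
  cintegral mu D f = cintegral mu setT (fun x => if x \in D then f x else 0).
Proof.
rewrite /cintegral; congr (_ +i* _)%C; rewrite Rintegral_mkcond; congr (Rintegral _ _ _);
 by apply/funext => x; rewrite /patch; case: ifP.
Qed.

(** Both sides are distributions in phi, and on balls the claim is the multiplicativity of the
    norm. *)
Lemma cintegral_scale z phi : z != 0 -> testfun phi ->
  cintegral mu setT (fun x => phi (x / z)) = (normR R z)%:C%C * cintegral mu setT phi.
Proof.
move=> z0 tphi.
apply: (@dist_eq_balls _ _ _ (fun phi => cintegral mu setT (fun x => phi (x / z)))
  (fun phi => (normR R z)%:C%C * cintegral mu setT phi)) => //.
- by move=> c f g tf tg /=; rewrite is_distribution_cintegral//; exact: testfun_div.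
- by move=> c f g tf tg /=; rewrite is_distribution_cintegral// mulrDr mulrCA.
exists 0%N => n a _ _; have pn0 := Xp_neq0 pp n.
under [X in cintegral _ _ X]funext do rewrite bfun_scale//.
by rewrite !(cintegrable_bfun _ _).2 ?mulf_neq0// normRM rmorphM.
Qed.

Lemma cintegral_shift a phi : testfun phi -> testfun (fun x => phi (x - a)) /\
  cintegral mu setT (fun x => phi (x - a)) = cintegral mu setT phi.
Proof.
have tf f : testfun f -> testfun (fun x => f (x - a)).
  move=> /testfunP[n [f1 f2]]; have [k ka] := expp_unbounded pp (pnorm a).
  apply/testfunP; exists (maxn n k); split=> [x y yn|x /f2 xn].
    by rewrite addrAC (f1 (x - a))// (le_trans yn)// exppV_le// leq_maxl.
  have -> : x = (x - a) + a by ring.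
  rewrite pnorm_leD// ?(le_trans xn) ?(le_trans (ltW ka))//.
    by apply: expp_le; rewrite ?leq_maxl.
  by apply: expp_le; rewrite ?leq_maxr.
move=> tphi; split; first exact: tf.
apply: (@dist_eq_balls _ _ _ (fun phi => cintegral mu setT (fun x => phi (x - a)))
  (cintegral mu setT)) => //.
- by move=> c f g tg tg' /=; rewrite is_distribution_cintegral//; exact: tf.
- exact: is_distribution_cintegral.
exists 0%N => n b _ _; have pn0 := Xp_neq0 pp n.
have -> : (fun x => bfun R b (p%:R ^+ n) (x - a)) = bfun R (b + a) (p%:R ^+ n).
  by apply/funext => x; rewrite /bfun opprD addrA addrAC.
by rewrite !(cintegrable_bfun _ _).2.
Qed.

End Integration.

(** * The Fourier transform on test functions *)

Section Fourier.
Variables (R : realType) (p : nat) (pp : prime p).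
Variable mu : {measure set (Qp_borel pp) -> \bar R}.
Hypothesis mu_haar : normalized_haar mu.
Local Notation C := (Cplx R).
Local Notation Qp := (Qp pp).
Local Notation fourier := (fourier mu).
Implicit Types (phi psi : Qp -> C) (x y a w z xi : Qp).

Lemma chi0 : chi R (0 : Qp) = 1.
Proof. by rewrite chi_Zp// pnorm0. Qed.

Lemma testfun_chiM xi phi : testfun phi -> testfun (fun x => chi R (xi * x) * phi x).
Proof.
move=> tphi; apply: (@testfunM _ _ _ (fun x => chi R (xi * x))) => // x _.
have [k kx] := expp_unbounded pp (pnorm xi).
apply/near_Qp; exists k => y yx.
have -> : xi * y = xi * (y - x) + xi * x by ring.
rewrite chiD chi_Zp ?mul1r// pnormM.
rewrite (le_trans (ler_wpM2l (pnorm_ge0 _) yx))//.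
by rewrite ler_pdivrMr ?exprn_gt0 ?rp_gt0// mul1r ltW.
Qed.

Lemma is_distribution_fourier xi : is_distribution (fun phi => fourier phi xi).
Proof.
move=> c phi psi tphi tpsi; rewrite /Defs.fourier.
rewrite -(is_distribution_cintegral mu_haar); try exact: testfun_chiM.
by congr cintegral; apply/funext => x; rewrite mulrDr mulrCA.
Qed.

(** If |xi w| <= 1, the character x |-> chi(xi x) is constant on the ball; otherwise it integrates
    to 0 there. All properties of F on test functions that involve its values rest on this
    formula. *)
Lemma fourier_bfun a w xi : w != 0 ->
  fourier (bfun R a w) xi = (normR R w)%:C%C * (chi R (xi * a) * bfun R 0 w^-1 xi).
Proof.
move=> w0; rewrite /Defs.fourier {2}/bfun subr0 pnormV.
have nw : 0 < pnorm w by rewrite pnorm_gt0.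
have tb := testfun_bfun R a w0.
have J0 := is_distribution0 (is_distribution_cintegral mu_haar).
case: ifPn => [xw|].
  have -> : (fun x => chi R (xi * x) * bfun R a w x) =
      (fun x => chi R (xi * a) * bfun R a w x + 0).
    apply/funext => x; rewrite addr0 /bfun; case: ifPn => [xa|]; last by rewrite !mulr0.
    have -> : xi * x = xi * (x - a) + xi * a by ring.
    rewrite chiD (@chi_Zp _ _ _ (xi * _)) ?mul1r// pnormM.
    rewrite (le_trans (ler_wpM2l (pnorm_ge0 _) xa))//.
    by rewrite -ler_pdivlMr// div1r.
  rewrite (is_distribution_cintegral mu_haar)//; last exact: testfun0.
  by rewrite J0 addr0 (cintegrable_bfun mu_haar _ _).2// mulr1 mulrC.
(* Translating by y = -1/(p xi), of norm at most |w|, multiplies the integral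
   by chi(1/p) <> 1. *)
rewrite -ltNge => xw; rewrite !mulr0.
have xi0 : xi != 0 by rewrite -pnorm_gt0 (lt_trans _ xw)// invr_gt0.
have nx : 0 < pnorm xi by rewrite pnorm_gt0.
have [_] := cintegral_shift mu_haar (- (p%:R^-1 / xi)) (testfun_chiM xi tb).
have -> : (fun x => chi R (xi * (x - - (p%:R^-1 / xi))) * bfun R a w (x - - (p%:R^-1 / xi))) =
  (fun x => chi R (p%:R^-1 : Qp) * (chi R (xi * x) * bfun R a w x) + 0).
  apply/funext => x; rewrite opprK mulrDr addr0 [xi * (_ / _)]mulrCA divff// mulr1.
  rewrite chiD [_ * chi R p%:R^-1]mulrC -mulrA; congr (_ * (_ * _)).
  apply: bfun_eq; rewrite addrC addKr pnormM !pnormV pnorm_p invrK.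
  have : pnorm xi^-1 < pnorm w by rewrite pnormV invf_plt ?posrE.
  move=> /pnorm_ltM; rewrite pnormM pnorm_p pnormV.
  by rewrite mulrC ler_pdivlMr ?rp_gt0// mulrC.
rewrite (is_distribution_cintegral mu_haar); [|exact: testfun_chiM|exact: testfun0].
rewrite J0 addr0 => /eqP; rewrite -subr_eq0 -{2}[cintegral _ _ _]mul1r -mulrBl mulf_eq0.
by rewrite subr_eq0 (negbTE (chi_pV R pp)) => /eqP.
Qed.

Lemma testfun_fourier phi : testfun phi -> testfun (fourier phi).
Proof.
move=> /testfunP[n fn]; have := level_expand fn; set w := p%:R ^- n => /= fE.
have tb i : testfun (bfun R (i%:R * w) (p%:R ^+ n)) by apply: testfun_bfun; exact: Xp_neq0.
have tfb i : testfun (fourier (bfun R (i%:R * w) (p%:R ^+ n))).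
  have -> : fourier (bfun R (i%:R * w) (p%:R ^+ n)) =
      (fun xi => (normR R (p%:R ^+ n : Qp))%:C%C *
        (chi R ((i%:R * w) * xi) * bfun R 0 (p%:R ^+ n)^-1 xi) + 0).
    by apply/funext => xi; rewrite fourier_bfun ?Xp_neq0// [_ * xi]mulrC addr0.
  apply: testfun_lin; last exact: testfun0.
  by apply: testfun_chiM; apply: testfun_bfun; rewrite invr_eq0 Xp_neq0.
have -> : fourier phi = fun xi => \sum_(k < p ^ (n + n)) phi (k%:R * w) *
    fourier (bfun R (k%:R * w) (p%:R ^+ n)) xi.
  apply/funext => xi; rewrite {1}fE.
  exact: (is_distribution_sum (p ^ (n + n)) (fun k => phi (k%:R * w))
    (is_distribution_fourier xi) tb).2.
exact: (is_distribution_sum (p ^ (n + n)) (fun k => phi (k%:R * w))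
    (is_distribution_fourier 0) tfb).1.
Qed.

Lemma fourier_lin (c : C) phi psi : testfun phi -> testfun psi ->
  fourier (fun x => c * phi x + psi x) = (fun xi => c * fourier phi xi + fourier psi xi).
Proof. by move=> tphi tpsi; apply/funext => xi; rewrite is_distribution_fourier. Qed.

(** On a ball the first transform yields the factor |w|, the dual ball of radius 1/|w| and the
    modulation chi(a xi). The second turns the modulation into a shift by a and contributes 1/|w|,
    which cancels |w|. *)
Lemma fourier_fourier phi : testfun phi ->
  fourier (fourier phi) = (fun x => phi (- x)).
Proof.
move=> tphi; apply/funext => x.
apply: (@dist_eq_balls _ _ _ (fun f => fourier (fourier f) x) (fun f => f (- x))) => //.
  move=> c f g tf tg /=; rewrite fourier_lin//.
  by rewrite is_distribution_fourier//; exact: testfun_fourier.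
exists 0%N => n a _ _; set w := p%:R ^+ n; have w0 : w != 0 := Xp_neq0 pp n.
have wV0 : w^-1 != 0 by rewrite invr_eq0.
have -> : fourier (bfun R a w) = fun xi => (normR R w)%:C%C *
    (chi R (a * xi) * bfun R 0 w^-1 xi) + 0.
  by apply/funext => xi; rewrite fourier_bfun// addr0 [a * _]mulrC.
rewrite is_distribution_fourier//; last exact: testfun0.
  rewrite (is_distribution0 (is_distribution_fourier x)) addr0.
  have -> : fourier (fun xi => chi R (a * xi) * bfun R 0 w^-1 xi) x =
      fourier (bfun R 0 w^-1) (x + a).
    by congr cintegral; apply/funext => y; rewrite mulrA -chiD -mulrDl.
  rewrite fourier_bfun// mulr0 chi0 mul1r mulrA -rmorphM/= -normRM divff// normR1.
  by rewrite mul1r invrK /bfun subr0 -opprD pnormN.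
by apply: testfun_chiM; exact: testfun_bfun.
Qed.

Lemma fourier_scale z phi : z != 0 -> testfun phi ->
  fourier (fun x => phi (x / z)) = (fun xi => (normR R z)%:C%C * fourier phi (z * xi)).
Proof.
move=> z0 tphi; apply/funext => xi; rewrite /Defs.fourier.
rewrite -(cintegral_scale mu_haar z0 (testfun_chiM (z * xi) tphi)).
have E x : z * xi * (x / z) = xi * x by rewrite [z * xi]mulrC -mulrA [z * _]mulrC divfK.
by congr cintegral; apply/funext => x; rewrite E.
Qed.

End Fourier.

(** * Multiplicative characters *)

Section MultiplicativeCharacters.
Variables (R : realType) (p : nat) (pp : prime p).
Local Notation C := (Cplx R).
Local Notation Qp := (Qp pp).
Local Notation cpow := (@cpow R).
Implicit Types (alpha : C) (om : Qp -> C) (x y a w z : Qp).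

Lemma cpowM (r s : R) (a : C) : 0 < r -> 0 < s -> cpow (r * s) a = cpow r a * cpow s a.
Proof.
move=> r0 s0; rewrite /Defs.cpow powRM ?(ltW r0) ?(ltW s0)// lnM ?posrE//.
by rewrite mulrDr cisD rmorphM mulrACA.
Qed.

Lemma cpowD (r : R) (a b : C) : 0 < r -> cpow r (a + b) = cpow r a * cpow r b.
Proof.
move=> r0; rewrite /Defs.cpow; case: a b => [a a'] [b b'] /=.
rewrite powRD; last by rewrite (gt_eqF r0) implybT.
by rewrite mulrDl cisD rmorphM mulrACA.
Qed.

Lemma cpowr1 (r : R) : 0 < r -> cpow r 1 = r%:C%C.
Proof. by move=> r0; rewrite /Defs.cpow /= powRr1 ?(ltW r0)// mul0r cis0 mulr1. Qed.

Lemma cpow0 (r : R) : cpow r 0 = 1.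
Proof. by rewrite /Defs.cpow /= powRr0 mul0r cis0 mulr1. Qed.

Lemma cpow1 (a : C) : cpow 1 a = 1.
Proof. by rewrite /Defs.cpow powR1 ln1 mulr0 cis0 mulr1. Qed.

Lemma cpowN (r : R) (a : C) : 0 < r -> cpow r (- a) = (cpow r a)^-1.
Proof.
move=> r0; have E : cpow r (- a) * cpow r a = 1 by rewrite -cpowD// addNr cpow0.
have a0 : cpow r a != 0.
  by apply: contra_eq_neq E => ->; rewrite mulr0 eq_sym oner_eq0.
by apply: (mulIf a0); rewrite mulVf.
Qed.

Lemma cpow_neq0 (r : R) (a : C) : 0 < r -> cpow r a != 0.
Proof.
move=> r0; have E : cpow r (- a) * cpow r a = 1 by rewrite -cpowD// addNr cpow0.
by apply: contra_eq_neq E => ->; rewrite mulr0 eq_sym oner_eq0.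
Qed.

Lemma cpowV (r : R) (a : C) : 0 < r -> cpow r^-1 a = (cpow r a)^-1.
Proof.
move=> r0; apply: (mulIf (cpow_neq0 a r0)).
by rewrite -cpowM ?invr_gt0// !mulVf ?cpow1 ?cpow_neq0// gt_eqF.
Qed.

(** The form in which a normed character is used: continuity becomes triviality on some 1 + p^(k+1)
    Z_p. The exponent is positive so that this set consists of units. The class is stable under
    inversion, as the dual character requires. *)
Definition lc_char om :=
  [/\ forall x y, x != 0 -> y != 0 -> om (x * y) = om x * om y,
      om p%:R = 1
    & exists k, forall x, pnorm (x - 1) <= p%:R ^- k.+1 -> om x = 1].

Lemma lc_char1 om : lc_char om -> om 1 = 1.
Proof.
by move=> [_ _ [k]]; apply; rewrite subrr pnorm0 invr_ge0 exprn_ge0// ler0n.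
Qed.

Lemma lc_char_neq0 om x : lc_char om -> x != 0 -> om x != 0.
Proof.
move=> h x0; have := lc_char1 h; case: h => hM _ _.
rewrite -(divff x0) hM ?invr_eq0// => E.
by apply: contra_eq_neq E => ->; rewrite mul0r eq_sym oner_eq0.
Qed.

Lemma lc_charV om : lc_char om -> lc_char (fun x => (om x)^-1).
Proof.
move=> [hM hp [k hk]]; split=> [x y x0 y0||].
- by rewrite hM// invfM.
- by rewrite hp invr1.
- by exists k => x /hk->; rewrite invr1.
Qed.

Lemma lc_charXp om n : lc_char om -> om (p%:R ^+ n) = 1.
Proof.
move=> h; elim: n => [|n IH]; first by rewrite expr0 lc_char1.
by case: h => hM hp _; rewrite exprS hM ?Qp_p_neq0 ?Xp_neq0// hp IH mulr1.
Qed.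

Lemma lc_charXpV om n : lc_char om -> om (p%:R ^- n) = 1.
Proof.
move=> h; have : om (p%:R ^+ n * p%:R ^- n) = 1 by rewrite mulfV ?Xp_neq0// lc_char1.
by case: (h) => hM _ _; rewrite hM ?invr_eq0 ?Xp_neq0// lc_charXp// mul1r.
Qed.

Lemma lc_char_trivial om : lc_char om -> (forall u, pnorm u = 1 -> om u = 1) ->
  forall x, x != 0 -> om x = 1.
Proof.
move=> om_lc hu x x0; have [n [u [u1 xE]]] := pnorm_decomp x0.
have u0 : u != 0 by rewrite -pnorm_gt0 u1.
have pV0 : (p%:R ^- n : Qp) != 0 by rewrite invr_eq0 Xp_neq0.
case: (om_lc) => hM _ _; case: xE => ->.
  by rewrite (hM _ _ (Xp_neq0 pp n) u0) (hu u u1) lc_charXp// mulr1.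
by rewrite (hM _ _ pV0 u0) (hu u u1) lc_charXpV// mulr1.
Qed.

Section Degree.
Variables (alpha : C) (om : Qp -> C).
Hypothesis om_lc : lc_char om.
Local Notation mch := (mchar alpha om).

Lemma mcharM x y : x != 0 -> y != 0 -> mch (x * y) = mch x * mch y.
Proof.
move=> x0 y0; rewrite /mchar normRM cpowM ?normR_gt0//; case: om_lc => hM _ _.
by rewrite hM// mulrACA.
Qed.

Lemma mchar_neq0 x : x != 0 -> mch x != 0.
Proof.
by move=> x0; rewrite /mchar mulf_neq0 ?cpow_neq0 ?normR_gt0 ?lc_char_neq0.
Qed.

Lemma mchar_unit x : pnorm x = 1 -> mch x = om x.
Proof. by move=> x1; rewrite /mchar /normR x1 rmorph1 cpow1 mul1r. Qed.

Lemma mchar1 : mch 1 = 1.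
Proof. by rewrite mchar_unit ?pnorm1// lc_char1. Qed.

Lemma mcharS x : x != 0 -> (normR R x)%:C%C * mch x = mchar (alpha + 1) om x.
Proof.
move=> x0; have n0 := normR_gt0 R x0; rewrite /mchar -(cpowr1 n0) mulrA -cpowD//.
by congr (cpow _ _ * _); ring.
Qed.

(** Dividing by x moves the ball about x into 1 + p^(k+1) Z_p. The radius of constancy is thus
    proportional to |x|, with one k for all x. *)
Lemma mchar_lc : exists k, forall x y, x != 0 -> pnorm (y - x) <= pnorm (p%:R ^+ k.+1 * x) ->
  mch y = mch x.
Proof.
case: (om_lc) => hM _ [k hk]; exists k => x y x0 yx.
have nx : 0 < pnorm x by rewrite pnorm_gt0.
have pk : (p%:R ^- k.+1 : rat) < 1.
  by rewrite invf_lt1 ?exprn_gt0 ?rp_gt0// exprn_egt1 ?rp_gt1.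
have ynx : pnorm y = pnorm x.
  apply: pnorm_isosceles; rewrite (le_lt_trans yx)// pnormM pnormXp.
  by rewrite gtr_pMl.
have y0 : y != 0 by rewrite -pnorm_gt0 ynx.
rewrite -[y](divfK x0) mcharM ?mulf_neq0 ?invr_eq0// mchar_unit; last first.
  by rewrite pnormM pnormV ynx divff// gt_eqF.
rewrite hk ?mul1r//; have -> : y / x - 1 = (y - x) / x by rewrite mulrBl divff.
by rewrite pnormM pnormV ler_pdivrMr//; move: yx; rewrite pnormM pnormXp.
Qed.

Lemma mchar_near x : x != 0 -> \forall y \near x, mch y = mch x.
Proof.
move=> x0; have [k hk] := mchar_lc; apply/near_Qp.
have n0 : 0 < pnorm (p%:R ^+ k.+1 * x) by rewrite pnorm_gt0 mulf_neq0// Xp_neq0.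
by have [n nx] := expp_small pp n0; exists n => y yx; apply: hk => //; rewrite (le_trans yx)// ltW.
Qed.

Lemma testfun_mchar phi : testfun phi -> phi 0 = 0 -> testfun (fun x => mch x * phi x).
Proof.
move=> tphi phi0; apply: testfunM => // x phix; apply: mchar_near.
by apply: contra_neq phix => ->.
Qed.

End Degree.

(* The unit circle has no small subgroups: while z^(2^m) stays within 1/2 of 1,
   each squaring multiplies the distance to 1 by at least 3/2. *)
Lemma eq1_of_double (z : C) : (forall m, `|z ^+ (2 ^ m) - 1| <= 2^-1) -> z = 1.
Proof.
move=> hz; apply/eqP; rewrite -subr_eq0; apply: contraT => z1.
pose r : R := complex.Re `|z - 1|.
have rE : `|z - 1| = r%:C%C by rewrite /r normc_def.
have r0 : 0 < r by rewrite -ltcR -rE normr_gt0.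
have H m : (1 + 2^-1 * m%:R)%:C%C * `|z - 1| <= `|z ^+ (2 ^ m) - 1|.
  elim: m => [|m IH]; first by rewrite mulr0 addr0 mul1r expn0 expr1.
  have -> : z ^+ (2 ^ m.+1) - 1 = (z ^+ (2 ^ m) - 1) * (z ^+ (2 ^ m) + 1).
    rewrite expnSr exprM; ring.
  rewrite normrM; set u := z ^+ (2 ^ m).
  have u1 : (3 / 2 : R)%:C%C <= `|u + 1|.
    have -> : u + 1 = 2 - (1 - u) by ring.
    apply: le_trans (lerB_dist _ _).
    have := hz m; rewrite -/u distrC => h.
    have -> : (3 / 2 : R)%:C%C = `|2| - 2^-1 :> C.
      by rewrite normr_nat rmorphM/= fmorphV/= !rmorph_nat; field.
    by rewrite lerD2l lerN2.
  apply: le_trans (ler_pM _ _ IH u1); rewrite ?mulr_ge0 ?normr_ge0 ?lecR//;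
    rewrite ?ler0c ?addr_ge0 ?mulr_ge0 ?invr_ge0 ?ler0n// .
  rewrite mulrAC ler_wpM2r ?normr_ge0// -rmorphM lecR -(natr1 m).
  have : 0 <= m%:R :> R by exact: ler0n.
  by lra.
pose m := (Num.truncn (r^-1)).+1.
have := le_trans (H m) (hz m).
have -> : 2^-1 = (2^-1 : R)%:C%C :> C by rewrite fmorphV/= rmorph_nat.
rewrite rE -rmorphM.
rewrite lecR => h; exfalso.
have : r^-1 < m%:R by exact: truncnS_gt.
rewrite -(ltr_pM2r r0) mulVf ?gt_eqF//; move: h r0; lra.
Qed.

Lemma open_Qp_star : open (Qp_star pp).
Proof.
rewrite openE => x /= x0; rewrite /interior; apply/near_Qp.
have nx : 0 < pnorm x by rewrite pnorm_gt0.
have [n xn] := expp_small pp nx; exists n => y yx.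
by rewrite /Qp_star/= -pnorm_gt0 (@pnorm_isosceles _ _ y x)// (le_lt_trans yx).
Qed.

(** Continuity at 1 keeps om within 1/2 of 1 on a small ball about 1. That ball contains all powers
    of its elements, so every om(x)^(2^m) stays near 1, and [eq1_of_double] forces om(x) = 1. *)
Lemma normed_char_lc om : normed_char om -> lc_char om.
Proof.
move=> [hM hc _ hp _]; split=> //.
move: hc; rewrite continuous_open_subspace; last exact: open_Qp_star.
have om1 : om 1 = 1.
  have p0 : om p%:R != 0 by rewrite hp oner_eq0.
  by apply: (mulfI p0); rewrite -hM ?oner_eq0 ?Qp_p_neq0// !mulr1.
move=> /(_ 1); rewrite inE => /(_ (oner_neq0 _)).
move=> /cvg_ballP/(_ 2^-1); rewrite invr_gt0 => /(_ (ltr0n _ 2)).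
move=> /near_Qp[n hn]; exists n => x xn.
have pk k : (p%:R ^- k : rat) <= 1.
  by rewrite invf_le1 ?exprn_gt0 ?rp_gt0// exprn_ege1// ltW// rp_gt1.
have x0 : x != 0.
  apply: contraTneq xn => ->; rewrite sub0r pnormN pnorm1 -ltNge.
  by rewrite invf_lt1 ?exprn_gt0 ?rp_gt0// exprn_egt1 ?rp_gt1.
have piX m : om (x ^+ m) = om x ^+ m.
  elim: m => [|m IH]; first by rewrite !expr0.
  by rewrite !exprS hM ?expf_neq0// IH.
have xm m : pnorm (x ^+ m - 1) <= p%:R ^- n.
  elim: m => [|m IH].
    by rewrite expr0 subrr pnorm0 invr_ge0 exprn_ge0// ler0n.
  have -> : x ^+ m.+1 - 1 = (x - 1) * x ^+ m + (x ^+ m - 1) by rewrite exprS; ring.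
  have x1 : pnorm x <= 1.
    have -> : x = (x - 1) + 1 by ring.
    by rewrite pnorm_leD ?pnorm1// (le_trans xn).
  rewrite pnorm_leD// pnormM pnormX (le_trans _ (le_trans xn (exppV_le pp (leqnSn n))))//.
  by rewrite ler_piMr ?pnorm_ge0// exprn_ile1// pnorm_ge0.
apply: eq1_of_double => m; rewrite -piX distrC -[X in `|X - _|]om1.
exact: ltW (hn _ (xm _)).
Qed.

End MultiplicativeCharacters.

(** * Homogeneous distributions *)

Section HomogeneousDistributions.
Variables (R : realType) (p : nat) (pp : prime p).
Variable mu : {measure set (Qp_borel pp) -> \bar R}.
Hypothesis mu_haar : normalized_haar mu.
Local Notation C := (Cplx R).
Local Notation Qp := (Qp pp).
Local Notation J := (cintegral mu [set: Qp]).
Local Notation b1 := (bfun R (0 : Qp) 1).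
Implicit Types (phi psi : Qp -> C) (x y a w z : Qp) (G : functional R pp).

Lemma testfun_b1 : testfun b1.
Proof. exact: testfun_bfun (oner_neq0 _). Qed.

Lemma bfun_center a w : bfun R a w a = 1.
Proof. by rewrite /bfun subrr pnorm0 pnorm_ge0. Qed.

Lemma testfun_minus_b1 (c : C) phi : testfun phi -> testfun (fun x => phi x - c * b1 x).
Proof.
move=> tphi; have -> : (fun x => phi x - c * b1 x) = (fun x => (- c) * b1 x + phi x).
  by apply/funext => x; rewrite mulNr addrC.
exact: testfun_lin testfun_b1 tphi.
Qed.

Lemma is_distribution_split G phi : is_distribution G -> testfun phi ->
  G phi = phi 0 * G b1 + G (fun x => phi x - phi 0 * b1 x).
Proof.
move=> dG tphi; rewrite -dG//; [|exact: testfun_b1|exact: testfun_minus_b1].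
by congr G; apply/funext => x; rewrite addrC subrK.
Qed.

(** Equivalently, [dilate G z] is deg(z) G for all z; the factor |z| is the Jacobian contained in
    [dilate]. *)
Definition homogeneous (deg : Qp -> C) G := forall z phi, z != 0 -> testfun phi ->
  G (fun x => phi (x / z)) = (normR R z)%:C%C * deg z * G phi.

Lemma pnorm_le1_pow x : x != 0 -> pnorm x <= 1 -> exists n, pnorm x = pnorm (p%:R ^+ n : Qp).
Proof.
move=> x0; have [n [u [u1 [->|->]]]] := pnorm_decomp x0.
  by exists n; rewrite pnormM u1 mulr1.
rewrite pnormM u1 mulr1 pnormV pnormXp invrK => n1; exists 0%N.
rewrite expr0 pnorm1; apply/le_anti; rewrite n1/=.
by rewrite exprn_ege1// ltW// rp_gt1.
Qed.

(** * The distribution pi_alpha and the classification of homogeneous distributions *)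

Section Degree.
Variables (alpha : C) (om : Qp -> C).
Hypothesis om_lc : lc_char om.
Local Notation mch := (mchar alpha om).
Local Notation T := (dmchar mu alpha om).
(* The factor pi_{alpha+1}(z) by which dilations act on distributions. *)
Let deg1 z : C := (normR R z)%:C%C * mch z.

(** The two regularised integrals merge because [b1] is the indicator of the unit ball. The
    integrand is now a test function, so the results on integrals of test functions apply. *)
Lemma dmcharE phi : testfun phi ->
  T phi = J (fun x => mch x * (phi x - phi 0 * b1 x)) + phi 0 * I0 alpha om.
Proof.
move=> tphi; rewrite /dmchar; congr (_ + _).
set f := fun x => phi x - phi 0 * b1 x.
have tf : testfun f := testfun_minus_b1 (phi 0) tphi.
have f0 : f 0 = 0 by rewrite /f bfun_center mulr1 subrr.
pose f1 x := b1 x * f x.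
have tf1 : testfun f1.
  apply: testfunM => // x _; exact: testfun_b1.1.
have tf2 : testfun (fun x => (-1) * f1 x + f x) by exact: testfun_lin.
rewrite (cintegral_mkcond mu (Qp_ball0 pp)) (cintegral_mkcond mu (~` Qp_ball0 pp)).
have -> : (fun x => if x \in Qp_ball0 pp then mch x * (phi x - phi 0) else 0) =
    (fun x => mch x * f1 x).
  apply/funext => x; rewrite /f1 /f /bfun subr0 pnorm1; case: ifPn => [|].
    by rewrite inE /Qp_ball0/= => ->; rewrite mul1r mulr1.
  by rewrite notin_setE /Qp_ball0/= => /negP/negbTE->; rewrite mul0r mulr0.
have -> : (fun x => if x \in ~` Qp_ball0 pp then mch x * phi x else 0) =
    (fun x => mch x * ((-1) * f1 x + f x)).
  apply/funext => x; rewrite /f1 /f /bfun subr0 pnorm1; case: ifPn => [|].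
    rewrite inE /Qp_ball0/= => /negP/negbTE->.
    by rewrite mul0r !mulr0 add0r subr0.
  rewrite notin_setE /Qp_ball0/= => /contrapT->.
  by rewrite mul1r mulN1r addNr mulr0.
have E := is_distribution_cintegral mu_haar.
rewrite -[J _ in LHS]mul1r -E; last 2 first.
- by apply: testfun_mchar => //; rewrite /f1 f0 mulr0.
- by apply: testfun_mchar => //; rewrite /f1 f0 mulr0 mulr0 addr0.
by congr (J _); apply/funext => x; rewrite -/(f x); ring.
Qed.

Lemma dmchar_vanish phi : testfun phi -> phi 0 = 0 -> T phi = J (fun x => mch x * phi x).
Proof.
move=> tphi phi0; rewrite dmcharE// phi0 mul0r addr0.
by congr (J _); apply/funext => x; rewrite mul0r subr0.
Qed.

Lemma dmchar_b1 : T b1 = I0 alpha om.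
Proof.
rewrite dmcharE ?bfun_center ?mul1r; last exact: testfun_b1.
have -> : (fun x => mch x * (b1 x - 1 * b1 x)) = fun=> 0.
  by apply/funext => x; rewrite mul1r subrr mulr0.
by rewrite (is_distribution0 (is_distribution_cintegral mu_haar)) add0r.
Qed.

Lemma is_distribution_dmchar : is_distribution T.
Proof.
move=> c phi psi tphi tpsi; rewrite !dmcharE//; last exact: testfun_lin.
have tm f : testfun f -> testfun (fun x => mch x * (f x - f 0 * b1 x)).
  move=> tf; apply: testfun_mchar => //; first exact: testfun_minus_b1.
  by rewrite bfun_center mulr1 subrr.
have -> : (fun x => mch x * (c * phi x + psi x - (c * phi 0 + psi 0) * b1 x)) =
  (fun x => c * (mch x * (phi x - phi 0 * b1 x)) + mch x * (psi x - psi 0 * b1 x)).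
  by apply/funext => x; ring.
rewrite (is_distribution_cintegral mu_haar); [ring|exact: tm|exact: tm].
Qed.

(** Away from 0 homogeneity is multiplicativity of the character combined with scaling of the
    integral; it holds for every degree, pi_0 included. *)
Lemma dmchar_vanish_scale z phi : z != 0 -> testfun phi -> phi 0 = 0 ->
  T (fun x => phi (x / z)) = deg1 z * T phi.
Proof.
move=> z0 tphi phi0; have tz := testfun_div z0 tphi.
have tm := testfun_mchar alpha om_lc tphi phi0.
rewrite !dmchar_vanish// ?mul0r//.
have J0 := is_distribution0 (is_distribution_cintegral mu_haar).
have -> : (fun x => mch x * phi (x / z)) =
    (fun x => mch z * (mch (x / z) * phi (x / z)) + 0).
  apply/funext => x; rewrite addr0 mulrA.
  have [->|x0] := eqVneq x 0; first by rewrite mul0r phi0 !mulr0.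
  have zx : z * (x / z) = x by rewrite mulrC divfK.
  have xz0 : x / z != 0 by rewrite mulf_neq0 ?invr_eq0.
  by rewrite -(mcharM _ om_lc z0 xz0) zx.
rewrite (is_distribution_cintegral mu_haar); [|exact: testfun_div z0 tm|exact: testfun0].
by rewrite J0 addr0 (cintegral_scale mu_haar z0 tm) mulrA [mch z * _]mulrC.
Qed.

(** pi_0 is the degree whose dilation factor pi_{alpha+1} is identically 1, and units together with
    p generate the multiplicative group. Contraposed, any other degree has some z with [deg1 z]
    different from 1. *)
Lemma deg1_pi0 : (forall u, pnorm u = 1 -> mch u = 1) -> deg1 p%:R = 1 ->
  forall x, x != 0 -> mch x = pi0 R x.
Proof.
move=> hu hp x x0; suff H : deg1 x = 1.
  have n0 := normRC_neq0 R x0.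
  by apply: (mulfI n0); rewrite -/(deg1 x) H /pi0 fmorphV mulfV.
have dM y z : y != 0 -> z != 0 -> deg1 (y * z) = deg1 y * deg1 z.
  by move=> y0 z0; rewrite /deg1 normRM rmorphM mcharM// mulrACA.
have d1 : deg1 1 = 1 by rewrite /deg1 normR1 mchar1 ?mul1r.
have dX n : deg1 (p%:R ^+ n) = 1.
  elim: n => [|n IH]; first by rewrite expr0.
  by rewrite exprS dM ?Qp_p_neq0 ?Xp_neq0// hp IH mulr1.
have dV y : y != 0 -> deg1 y = 1 -> deg1 y^-1 = 1.
  move=> y0 y1; have yV0 : y^-1 != 0 by rewrite invr_eq0.
  by have := dM y y^-1 y0 yV0; rewrite (mulfV y0) d1 y1 mul1r => <-.
have du u : pnorm u = 1 -> deg1 u = 1.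
  by move=> u1; rewrite /deg1 hu// /normR u1 rmorph1 mulr1.
have [n [u [u1 xE]]] := pnorm_decomp x0; have u0 : u != 0 by rewrite -pnorm_gt0 u1.
case: xE => ->.
  by rewrite (dM _ _ (Xp_neq0 pp n) u0) dX mul1r du.
have pV0 : (p%:R ^- n : Qp) != 0 by rewrite invr_eq0 Xp_neq0.
by rewrite (dM _ _ pV0 u0) (du u u1) mulr1; apply: dV (dX n); exact: Xp_neq0.
Qed.

Let sphere x : C := (-1) * bfun R 0 p%:R x + b1 x.

Lemma testfun_sphere : testfun sphere.
Proof. exact: testfun_lin (testfun_bfun R 0 (Qp_p_neq0 pp)) testfun_b1. Qed.

Lemma sphere0 : sphere 0 = 0.
Proof. by rewrite /sphere !bfun_center mulr1 addNr. Qed.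

Lemma sphere_unit x : sphere x != 0 -> pnorm x = 1.
Proof.
rewrite /sphere /bfun subr0 pnorm_p pnorm1.
have pV1 : (p%:R^-1 : rat) <= 1 by rewrite invf_le1 ?rp_gt0// ltW// rp_gt1.
case: ifPn => [xp|xp]; first by rewrite (le_trans xp pV1) mulr1 addNr eqxx.
case: ifPn => [x1 _|_]; last by rewrite mulr0 addr0 eqxx.
apply/le_anti; rewrite x1/= leNgt; apply: contra xp; exact: pnorm_lt1.
Qed.

Lemma cintegral_sphere : J sphere = 1 - p%:R^-1.
Proof.
rewrite (is_distribution_cintegral mu_haar); [|exact: testfun_bfun (Qp_p_neq0 pp)|exact: testfun_b1].
rewrite !(cintegrable_bfun mu_haar _ _).2 ?oner_neq0 ?Qp_p_neq0//.
have := normRXp R pp 1; rewrite !expr1 normR1 => ->.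
by rewrite fmorphV/= rmorph_nat mulN1r addrC.
Qed.

Lemma cintegral_sphere_neq0 : J sphere != 0.
Proof.
rewrite cintegral_sphere subr_eq0 eq_sym invr_eq1 -[1]/(1%:R) eqr_nat.
by apply: contraTneq (prime_gt1 pp) => ->.
Qed.

Lemma dmchar_sphere_trivial : (forall x, x != 0 -> om x = 1) -> T sphere = 1 - p%:R^-1.
Proof.
move=> om1; rewrite dmchar_vanish ?sphere0//; last exact: testfun_sphere.
rewrite -cintegral_sphere; congr (J _); apply/funext => x.
have [->|/sphere_unit x1] := eqVneq (sphere x) 0; first by rewrite mulr0.
by rewrite mchar_unit// om1 ?mul1r// -pnorm_gt0 x1.
Qed.

(** Functions vanishing at 0 being settled, only the test function [b1] remains. The z for which
    homogeneity holds are closed under products and inverses, so units and p suffice. A unit fixes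
    [b1], and there either om = 1 or [I0] = 0. *)
Lemma dmchar_homogeneous : ~ (forall x, x != 0 -> mch x = pi0 R x) ->
  homogeneous mch T.
Proof.
move=> npi0.
have b1_scale z : z != 0 -> T (fun x => b1 (x / z)) = deg1 z * T b1 ->
    forall phi, testfun phi -> T (fun x => phi (x / z)) = deg1 z * T phi.
  move=> z0 hz phi tphi; have dT := is_distribution_dmchar.
  rewrite (is_distribution_split dT tphi) mulrDr.
  rewrite -dmchar_vanish_scale//; last 2 first.
  - exact: testfun_minus_b1.
  - by rewrite bfun_center mulr1 subrr.
  rewrite mulrCA -hz -dT; last 2 first.
  - exact: testfun_div z0 testfun_b1.
  - by apply: (@testfun_div _ _ _ z (fun x => phi x - phi 0 * b1 x)) => //; exact: testfun_minus_b1.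
  by congr T; apply/funext => x; rewrite addrC subrK.
pose H z := forall phi, testfun phi -> T (fun x => phi (x / z)) = deg1 z * T phi.
have dM y z : y != 0 -> z != 0 -> deg1 (y * z) = deg1 y * deg1 z.
  by move=> y0 z0; rewrite /deg1 normRM rmorphM mcharM// mulrACA.
have HM y z : y != 0 -> z != 0 -> H y -> H z -> H (y * z).
  move=> y0 z0 hy hz phi tphi; rewrite dM// -mulrA -hz// -hy; last exact: testfun_div.
  by congr T; apply/funext => x; rewrite invfM mulrA.
have HV z : z != 0 -> H z -> H z^-1.
  move=> z0 hz phi tphi; have zV0 : z^-1 != 0 by rewrite invr_eq0.
  have := hz _ (testfun_div zV0 tphi).
  have -> : (fun x => phi (x / z / z^-1)) = phi.
    by apply/funext => x; rewrite invrK divfK.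
  move=> E; rewrite [in RHS]E mulrA -(dM _ _ zV0 z0) (mulVf z0).
  by rewrite /deg1 normR1 mchar1// !mul1r.
have Tp : T (bfun R 0 p%:R) = T b1 - T sphere.
  rewrite is_distribution_dmchar; [|exact: testfun_bfun (Qp_p_neq0 pp)|exact: testfun_b1].
  by move: (T (bfun R 0 p%:R)) (T b1) => u v; ring.
have b1E z : z != 0 -> (fun x => b1 (x / z)) = bfun R 0 z.
  by move=> z0; apply/funext => x; rewrite bfun_scale// mulr0 mulr1.
have Hu u : pnorm u = 1 -> H u.
  move=> u1; have u0 : u != 0 by rewrite -pnorm_gt0 u1.
  apply: b1_scale => //; rewrite b1E// (@bfun_radius _ _ _ 0 u 1) ?pnorm1//.
  rewrite dmchar_b1 /I0 /deg1 /normR u1 rmorph1 mul1r mchar_unit//.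
  by case: asboolP => [om1|_]; rewrite ?om1 ?mul1r ?mulr0.
have Hp : H p%:R.
  have p0 := Qp_p_neq0 pp.
  apply: b1_scale => //; rewrite b1E// Tp dmchar_b1 /I0.
  case: asboolP => [om1|nom1].
    rewrite dmchar_sphere_trivial//.
    have dp : deg1 p%:R = cpow p%:R (- alpha).
      rewrite /deg1 mcharS// /mchar addrK om1// mulr1.
      have := normRXp R pp 1; rewrite !expr1 => ->.
      by rewrite cpowV ?ltr0n ?prime_gt0// cpowN// ltr0n prime_gt0.
    rewrite dp; have : cpow p%:R (- alpha) != 1.
      rewrite -dp; apply/eqP => dp1; apply: npi0; apply: deg1_pi0 => // u u1.
      by rewrite mchar_unit// om1// -pnorm_gt0 u1.
    rewrite -subr_eq0 -opprB oppr_eq0 => q0.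
    (* Homogeneity at p reads I0 (1 - q) = 1 - 1/p with q = p^-alpha: the equation that dictates the
       value of [I0]. Excluding pi_0 gives q <> 1. *)
    set q := cpow _ _ in q0 *; set s := 1 - p%:R^-1.
    by apply: (mulIf q0); rewrite mulrBl mulrA !divfK//; ring.
  (* For nontrivial om, [I0] is 0. The sphere is invariant under the unit u, while its value under T
     is multiplied by om(u) <> 1, so that value is 0 too. *)
  have [u u1 omu] : exists2 u, pnorm u = 1 & om u != 1.
    apply: contrapT => h; apply: nom1; apply: (lc_char_trivial om_lc) => u u1.
    by apply: contrapT => /eqP omu; apply: h; exists u.
  have u0 : u != 0 by rewrite -pnorm_gt0 u1.
  have := dmchar_vanish_scale u0 testfun_sphere sphere0.
  have -> : (fun x => sphere (x / u)) = sphere.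
    by apply/funext => x; rewrite /sphere /bfun !subr0 pnormM pnormV u1 invr1 mulr1.
  rewrite /deg1 /normR u1 rmorph1 mul1r mchar_unit// => /eqP.
  rewrite -subr_eq0 -{1}[T sphere]mul1r -mulrBl mulf_eq0 subr_eq0 eq_sym (negbTE omu)/=.
  by move=> /eqP->; rewrite subr0 mulr0.
have HX n : H (p%:R ^+ n).
  elim: n => [|n IH]; first by apply: Hu; rewrite expr0 pnorm1.
  by rewrite exprS; apply: HM => //; rewrite ?Qp_p_neq0 ?Xp_neq0.
move=> z phi z0 tphi; rewrite -/(deg1 z); apply: (_ : H z) tphi.
have [n [u [u1 [->|->]]]] := pnorm_decomp z0; have u0 : u != 0 by rewrite -pnorm_gt0 u1.
  exact: (HM _ _ (Xp_neq0 pp n) u0 (HX n) (Hu _ u1)).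
have pV0 : (p%:R ^- n : Qp) != 0 by rewrite invr_eq0 Xp_neq0.
exact: (HM _ _ pV0 u0 (HV _ (Xp_neq0 pp n) (HX n)) (Hu _ u1)).
Qed.

(** Near 1, where pi_alpha is constant, G behaves as c times Haar measure on balls; dilations
    transport this density to all nonzero centres. The constant c is G of the ball 1 + w0 Z_p
    divided by its measure. *)
Lemma homogeneous_vanish G : is_distribution G -> homogeneous mch G ->
  exists c : C, forall phi, testfun phi -> phi 0 = 0 -> G phi = c * T phi.
Proof.
move=> dG hG; have [k hk] := mchar_lc alpha om_lc.
pose w0 : Qp := p%:R ^+ k.+1; have w00 : w0 != 0 := Xp_neq0 pp _.
have nw0 : pnorm w0 < 1.
  by rewrite pnormXp invf_lt1 ?exprn_gt0 ?rp_gt0// exprn_egt1 ?rp_gt1.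
pose c := G (bfun R 1 w0) / (normR R w0)%:C%C; exists c.
have Ga a w : a != 0 -> w != 0 ->
    G (bfun R a w) = (normR R a)%:C%C * mch a * G (bfun R 1 (w / a)).
  move=> a0 w1; rewrite -hG//; last by apply: testfun_bfun; rewrite mulf_neq0 ?invr_eq0.
  by congr G; apply/funext => x; rewrite bfun_scale// mulr1 mulrC divfK.
(* The centres 1 + i w0 of the subballs have norm 1 and pi_alpha is 1 there. Dilation by a centre
   carries the subball about 1 onto the one about that centre, so all p^j subballs have the same
   value under G. *)
have G1 v : v != 0 -> pnorm v <= pnorm w0 -> G (bfun R 1 v) = (normR R v)%:C%C * c.
  move=> v0 vw; have [j jE] : exists j, pnorm v = pnorm (p%:R ^+ j * w0).
    have [||j jE] := @pnorm_le1_pow (v / w0).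
    - by rewrite mulf_neq0 ?invr_eq0.
    - by rewrite pnormM pnormV ler_pdivrMr ?pnorm_gt0// mul1r.
    by exists j; rewrite pnormM -jE -pnormM divfK.
  rewrite (bfun_radius _ _ jE); have -> : normR R v = normR R (p%:R ^+ j * w0).
    by rewrite /normR jE.
  set v' := p%:R ^+ j * w0; have v'0 : v' != 0 by rewrite mulf_neq0 ?Xp_neq0.
  have tb (i : nat) : testfun (bfun R (1 + i%:R * w0) v') by exact: testfun_bfun.
  have E : bfun R 1 w0 = fun x => \sum_(i < p ^ j) 1 * bfun R (1 + i%:R * w0) v' x.
    apply/funext => x; rewrite (bfun_split _ _ j)//.
    by apply: eq_bigr => i _; rewrite mul1r.
  rewrite /c E (is_distribution_sum (p ^ j) (fun=> 1) dG tb).2.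
  rewrite (eq_bigr (fun=> G (bfun R 1 v'))); last first.
    move=> i _; rewrite mul1r.
    have ib : pnorm (1 + i%:R * w0 - 1) <= pnorm w0.
      by rewrite addrC addKr pnormM ler_piMl ?pnorm_ge0 ?pnorm_nat.
    have i1 : pnorm (1 + i%:R * w0) = 1.
      rewrite -(pnorm1 pp); apply: pnorm_isosceles.
      by rewrite pnorm1 (le_lt_trans ib).
    have i0 : 1 + i%:R * w0 != 0 by rewrite -pnorm_gt0 i1.
    rewrite Ga// /normR i1 rmorph1 mul1r (hk 1) ?oner_neq0 ?mulr1// mchar1// mul1r.
    by rewrite (@bfun_radius _ _ _ 1 _ v')// pnormM pnormV i1 invr1 mulr1.
  rewrite sumr_const card_ord -mulr_natl /v' normRM rmorphM/= normRXp.
  rewrite fmorphV/= rmorphXn/= rmorph_nat natrX.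
  have pj0 : p%:R ^+ j != 0 :> C by rewrite expf_neq0// pnatr_eq0 -lt0n prime_gt0.
  have := normRC_neq0 R w00; set W := (_%:C)%C => W0; set g := G _.
  have aux (A B D : C) : A != 0 -> B != 0 -> D = A^-1 * B * (A * D / B).
    by move=> A0 B0; field; rewrite A0 B0.
  exact: aux.
move=> phi tphi phi0; apply: (@dist_eq_balls _ _ _ G (fun f => c * T f)) => //.
  by move=> d f g tf tg /=; rewrite is_distribution_dmchar// mulrDr mulrCA.
(* As phi(0) = 0, phi vanishes on the ball of radius p^-m, so |a| > p^-m. A radius of at most
   p^-(m+k+1) is then below |w0 a|, and pi_alpha is constant on the ball about a. *)
have /testfunP[m [f1 f2]] := tphi; exists (m + k.+1)%N => n a mn phia.
have am : p%:R ^- m < pnorm a.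
  rewrite ltNge; apply: contra phia => am.
  by rewrite -[a]add0r f1// phi0.
have a0 : a != 0 by apply: contra_neq phia => ->.
have na : 0 < pnorm a by rewrite pnorm_gt0.
set w := p%:R ^+ n; have ww : w != 0 := Xp_neq0 pp n.
have wa : pnorm w <= pnorm (w0 * a).
  rewrite pnormXp pnormM pnormXp (le_trans (exppV_le pp mn))//.
  rewrite exprD invfM mulrC ler_pM2l; first exact: ltW.
  by rewrite invr_gt0 exprn_gt0 ?rp_gt0.
have wa' : pnorm w < pnorm a.
  by rewrite (le_lt_trans wa)// pnormM gtr_pMl.
rewrite Ga// G1 ?mulf_neq0 ?invr_eq0//; last first.
  by rewrite pnormM pnormV ler_pdivrMr// -pnormM.
have tb := testfun_bfun R a ww.
have b0 : bfun R a w 0 = 0 by rewrite /bfun sub0r pnormN leNgt wa'.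
rewrite dmchar_vanish//.
have -> : (fun x => mch x * bfun R a w x) = (fun x => mch a * bfun R a w x + 0).
  apply/funext => x; rewrite addr0 /bfun; case: ifPn => [xa|]; last by rewrite !mulr0.
  by rewrite (hk a)// (le_trans xa)// -/w0.
rewrite (is_distribution_cintegral mu_haar)//; last exact: testfun0.
rewrite (is_distribution0 (is_distribution_cintegral mu_haar)) addr0.
rewrite (cintegrable_bfun mu_haar _ _).2//.
have -> : (normR R (w / a))%:C%C = (normR R w)%:C%C / (normR R a)%:C%C :> C.
  by rewrite normRM normRV (rmorphM (real_complex R)) fmorphV.
have aux (A B D E : C) : A != 0 -> A * B * (D / A * E) = E * (B * D).
  by move=> A0; field.
exact: aux (normRC_neq0 R a0).
Qed.

(** The difference D = G - c T sees only phi(0), which dilations preserve, so D(b1(x/z)) = D(b1).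
    Homogeneity makes the left side deg1(z) D(b1); a z with deg1(z) <> 1 gives D(b1) = 0. *)
Lemma homogeneous_unique G : ~ (forall x, x != 0 -> mch x = pi0 R x) ->
  is_distribution G -> homogeneous mch G ->
  exists c : C, forall phi, testfun phi -> G phi = c * T phi.
Proof.
move=> npi0 dG hG; have [c hc] := homogeneous_vanish dG hG; exists c => phi tphi.
have hT := dmchar_homogeneous npi0; have dT := is_distribution_dmchar.
have [z z0 dz] : exists2 z, z != 0 & deg1 z != 1.
  apply: contrapT => h; apply: npi0; apply: deg1_pi0 => [u u1|].
    apply: contrapT => /eqP mu1; apply: h; exists u; first by rewrite -pnorm_gt0 u1.
    by rewrite /deg1 /normR u1 rmorph1 mul1r.
  by apply: contrapT => /eqP dp; apply: h; exists p%:R => //; exact: Qp_p_neq0.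
suff b : G b1 = c * T b1.
  rewrite (is_distribution_split dG tphi) (is_distribution_split dT tphi) b.
  rewrite (hc _ (testfun_minus_b1 (phi 0) tphi)) ?bfun_center ?mulr1 ?subrr//.
  by ring.
have tz := testfun_div z0 testfun_b1.
have E : G (fun x => b1 (x / z)) - c * T (fun x => b1 (x / z)) = G b1 - c * T b1.
  rewrite (is_distribution_split dG tz) (is_distribution_split dT tz).
  have t' := testfun_minus_b1 (b1 (0 / z)) tz.
  rewrite (hc _ t') ?mul0r bfun_center ?mulr1 ?subrr// !mul1r.
  by ring.
move: E; rewrite hG ?hT//; try exact: testfun_b1.
rewrite -/(deg1 z) [c * _]mulrCA -mulrBr => /eqP.
rewrite -subr_eq0 -{2}[G b1 - _]mul1r -mulrBl mulf_eq0 subr_eq0 (negbTE dz)/= subr_eq0.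
by move=> /eqP.
Qed.

(** All dilation factors are 1, so G agrees on the indicators of Z_p and p Z_p and vanishes on the
    sphere. On the sphere pi_0 is 1, and c T gives c (1 - 1/p) there. *)
Lemma homogeneous_pi0 G : (forall x, x != 0 -> mch x = pi0 R x) ->
  is_distribution G -> homogeneous mch G ->
  exists c : C, forall phi, testfun phi -> G phi = c * phi 0.
Proof.
move=> epi0 dG hG; have [c hc] := homogeneous_vanish dG hG.
have c0 : c = 0.
  have p0 := Qp_p_neq0 pp.
  have : G sphere = 0.
    rewrite /sphere dG; [|exact: testfun_bfun p0|exact: testfun_b1].
    have -> : bfun R 0 p%:R = fun x => b1 (x / p%:R).
      by apply/funext => x; rewrite bfun_scale// mulr0 mulr1.
    rewrite hG//; last exact: testfun_b1.
    rewrite epi0// /pi0 fmorphV/= mulfV; first by rewrite mul1r mulN1r addNr.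
    exact: normRC_neq0.
  rewrite hc ?sphere0//; last exact: testfun_sphere.
  rewrite dmchar_vanish ?sphere0//; last exact: testfun_sphere.
  have -> : (fun x => mch x * sphere x) = sphere.
    apply/funext => x; have [->|/sphere_unit x1] := eqVneq (sphere x) 0; first by rewrite mulr0.
    by rewrite epi0 -?pnorm_gt0 ?x1// /pi0 /normR x1 rmorph1 invr1 mul1r.
  by move=> /eqP; rewrite mulf_eq0 (negbTE cintegral_sphere_neq0) orbF => /eqP.
exists (G b1) => phi tphi; rewrite (is_distribution_split dG tphi).
rewrite (hc _ (testfun_minus_b1 (phi 0) tphi)) ?bfun_center ?mulr1 ?subrr//.
by rewrite c0 mul0r addr0 mulrC.
Qed.

End Degree.

End HomogeneousDistributions.

(** * Quasi-asymptotics *)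

Section Limits.
Variables (K : numClosedFieldType) (T : Type) (F : set_system T).
Context {FF : Filter F}.

Lemma cvg_near_eq (u v : T -> K) (l : K) :
  (\forall t \near F, u t = v t) -> v t @[t --> F] --> l -> u t @[t --> F] --> l.
Proof.
move=> uv; apply: cvg_trans; apply: near_eq_cvg; apply: filterS uv => t.
by move=> ->.
Qed.

Lemma cvg_mul (u v : T -> K) (l m : K) :
  u t @[t --> F] --> l -> v t @[t --> F] --> m -> u t * v t @[t --> F] --> l * m.
Proof. by move=> ul vm; exact: cvgM ul vm. Qed.

Lemma cvg_scale (u : T -> K) (c l : K) :
  u t @[t --> F] --> l -> c * u t @[t --> F] --> c * l.
Proof. by move=> ul; apply: cvg_mul ul; exact: cvg_cst. Qed.

End Limits.

(** * Homogeneity of the limits and their transport by the Fourier transform *)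

Section DistributionOperators.
Variables (R : realType) (p : nat) (pp : prime p).
Local Notation C := (Cplx R).
Local Notation Qp := (Qp pp).
Implicit Types (phi psi : Qp -> C) (x y z t : Qp) (f g h G : functional R pp).

Lemma is_distributionZ G (c : C) phi : is_distribution G -> testfun phi ->
  G (fun x => c * phi x) = c * G phi.
Proof.
move=> dG tphi; have := dG c _ _ tphi (testfun0 R pp).
rewrite (is_distribution0 dG) addr0 => <-.
by congr G; apply/funext => x; rewrite addr0.
Qed.


(** The dilation factor of the dual degree is the inverse of pi_alpha, matching the passage from z
    to 1/z under F. *)
Lemma mchar_dual (alpha : C) (om : Qp -> C) z : z != 0 ->
  (normR R z)%:C%C * mchar (1 - alpha) (fun x => (om x)^-1) z = (mchar alpha om z)^-1.
Proof.
move=> z0; have n0 := normR_gt0 R z0; rewrite /mchar -(cpowr1 n0) mulrA -cpowD//.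
rewrite invfM -cpowN//; congr (cpow _ _ * _); ring.
Qed.


Lemma near_infty_neq0 : \forall t \near Qp_infty pp, t != 0.
Proof. by exists 0 => // t; rewrite /= pnorm_gt0. Qed.


Lemma cvg_infty_mulr z : z != 0 -> t * z @[t --> Qp_infty pp] --> Qp_infty pp.
Proof.
move=> z0 A [M _ MA]; exists (M / pnorm z) => // t /=.
by rewrite ltr_pdivrMr ?pnorm_gt0// -pnormM => /MA.
Qed.


Lemma qasympt_infty_eq (deg rho : Qp -> C) f g h : dist_eq g h ->
  qasympt_infty deg rho f g -> qasympt_infty deg rho f h.
Proof.
move=> gh [am dg ng lg]; split; first exact: am.
- move=> c phi psi tphi tpsi.
  by rewrite -(gh _ tphi) -(gh _ tpsi) -(gh _ (testfun_lin c tphi tpsi)); exact: dg.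
- by move=> h0; apply: ng => phi tphi; rewrite (gh _ tphi) (h0 _ tphi).
- by move=> phi tphi; rewrite -(gh _ tphi); exact: lg.
Qed.


Lemma qasympt_zero_eq (deg rho : Qp -> C) f g h : dist_eq g h ->
  qasympt_zero deg rho f g -> qasympt_zero deg rho f h.
Proof.
move=> gh [am dg ng lg]; split; first exact: am.
- move=> c phi psi tphi tpsi.
  by rewrite -(gh _ tphi) -(gh _ tpsi) -(gh _ (testfun_lin c tphi tpsi)); exact: dg.
- by move=> h0; apply: ng => phi tphi; rewrite (gh _ tphi) (h0 _ tphi).
- by move=> phi tphi; rewrite -(gh _ tphi); exact: lg.
Qed.


Lemma continuous_Qp_star (f : Qp -> C) : {within Qp_star pp, continuous f} <->
  forall x, x != 0 -> f y @[y --> x] --> f x.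
Proof.
rewrite continuous_open_subspace; last exact: open_Qp_star.
split=> fc x; first by move=> x0; apply: fc; rewrite inE.
by rewrite inE => x0; exact: fc.
Qed.

Lemma automodel_norm (alpha : C) (om rho : Qp -> C) :
  automodel (mchar alpha om) rho ->
  automodel (mchar (alpha + 1) om) (fun t => (normR R t)%:C%C * rho t).
Proof.
move=> [/continuous_Qp_star cr lr]; split.
  apply/continuous_Qp_star => x x0.
  apply: (@cvgM _ _ (nbhs x) _ (fun t : Qp => (normR R t)%:C%C : C) rho); last exact: cr x0.
  apply: cvg_near_cst; apply/near_Qp; have nx : 0 < pnorm x by rewrite pnorm_gt0.
  have [n xn] := expp_small pp nx; exists n => y yx.
  by rewrite /normR (@pnorm_isosceles _ _ y x)// (le_lt_trans yx).
move=> z z0; rewrite -mcharS//.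
have FI : Filter (Qp_infty pp) by exact: _.
have l1 := @cvg_scale C _ _ FI _ (normR R z)%:C%C _ (lr z z0).
apply: cvg_near_eq l1.
apply: filterS near_infty_neq0 => t t0 /=.
have n0 := normRC_neq0 R t0.
have aux (A B D E : C) : A != 0 -> B * (D / E) = A * B * D / (A * E).
  by move=> A0; rewrite invfM mulrACA [A * B]mulrC mulfK.
by rewrite /= normRM (rmorphM (real_complex R)) (aux _ _ _ _ n0).
Qed.


(** The limit of f(t z x) / rho(t) is computed twice: directly with dilated test function, and as
    the product of rho(t z) / rho(t) with f(t z x) / rho(t z). Uniqueness of limits gives the
    claim. *)
Lemma qasympt_infty_homogeneous (alpha : C) (om rho : Qp -> C) f g : lc_char om ->
  qasympt_infty (mchar alpha om) rho f g -> homogeneous (mchar alpha om) g.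
Proof.
move=> om_lc [[_ am] dg _ lg] z phi z0 tphi.
have lz := lg _ (testfun_div z0 tphi).
have mz := mchar_neq0 alpha om_lc z0.
have hC : hausdorff_space C by apply: norm_hausdorff.
apply: (cvg_unique hC) lz _.
have l1 := cvg_comp _ _ (cvg_infty_mulr z0) (lg _ tphi).
(* The limit pi_alpha(z) is nonzero, so the quotient is eventually nonzero. This gives rho(t z) <> 0
   for large t, which allows its cancellation below. *)
have nz : \forall t \near Qp_infty pp, rho (t * z) / rho t != 0.
  have /cvg_ballP/(_ `|mchar alpha om z|) := am z z0.
  rewrite normr_gt0 => /(_ mz); apply: filterS => t /=.
  rewrite -ball_normE/= => h; apply: contraTneq h => ->.
  by rewrite subr0 ltxx.
have -> : (normR R z)%:C%C * mchar alpha om z * g phi =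
   (normR R z)%:C%C * (mchar alpha om z * g phi) by rewrite -mulrA.
have FI : Filter (Qp_infty pp) by exact: _.
have l2 := @cvg_scale C _ _ FI _ (normR R z)%:C%C _
  (@cvg_mul C _ _ FI _ _ _ _ (am z z0) l1).
apply: cvg_near_eq l2.
apply: filterS2 near_infty_neq0 nz => t t0 rz /=.
rewrite /dilate.
have -> : (fun x => phi (x / t / z)) = (fun x => phi (x / (t * z))).
  by apply/funext => x; rewrite invfM mulrA.
set F := f _; move: rz; rewrite mulf_eq0 invr_eq0 negb_or => /andP[r1 r2].
have -> : ((normR R (t * z))^-1)%:C%C = (normR R t)%:C%C^-1 / (normR R z)%:C%C :> C.
  by rewrite normRM fmorphV (rmorphM (real_complex R)) invfM.
have -> : ((normR R t)^-1)%:C%C = (normR R t)%:C%C^-1 :> C by rewrite fmorphV.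
have aux (A B D E H : C) : A != 0 -> D != 0 -> A * (D / E * (B / A * H / D)) = B * H / E.
  move=> A0 D0; rewrite mulrACA; have [->|E0] := eqVneq E 0; first by rewrite invr0 !(mulr0, mul0r).
  by field; rewrite A0 D0 E0.
exact: esym (aux _ _ _ _ _ (normRC_neq0 R z0) r1).
Qed.


(* F is the Fourier transform; only these properties of it matter here. *)
Variable F : (Qp -> C) -> Qp -> C.
Hypothesis F_lin : forall (c : C) phi psi, testfun phi -> testfun psi ->
  F (fun x => c * phi x + psi x) = (fun x => c * F phi x + F psi x).
Hypothesis F_testfun : forall phi, testfun phi -> testfun (F phi).
Hypothesis F_scale : forall z phi, z != 0 -> testfun phi ->
  F (fun x => phi (x / z)) = (fun x => (normR R z)%:C%C * F phi (z * x)).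
Hypothesis F_invol : forall phi, testfun phi -> F (F phi) = (fun x => phi (- x)).

Definition pullback G : functional R pp := fun phi => G (F phi).

Lemma is_distribution_pullback G : is_distribution G -> is_distribution (pullback G).
Proof.
move=> dG c phi psi tphi tpsi; rewrite /pullback F_lin// dG//;
exact: F_testfun.
Qed.


(** F squared is the reflection, and [F_scale] with z = -1 shows that reflection commutes with F;
    hence the reflected F phi is a preimage of phi. *)
Lemma involution_surj phi : testfun phi ->
  testfun (fun x => F phi (- x)) /\ F (fun x => F phi (- x)) = phi.
Proof.
move=> tphi; have tF := F_testfun tphi.
have N0 : (-1 : Qp) != 0 by rewrite oppr_eq0 oner_eq0.
have -> : (fun x => F phi (- x)) = (fun x => F phi (x / -1)).
  by apply/funext => x; rewrite invrN1 mulrN1.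
split; first exact: testfun_div.
rewrite F_scale//; apply/funext => x.
rewrite F_invol// mulN1r opprK.
by rewrite /normR pnormN pnorm1 rmorph1 mul1r.
Qed.


Lemma homogeneous_pullback (alpha : C) (om : Qp -> C) G : lc_char om ->
  is_distribution G -> homogeneous (mchar alpha om) G ->
  homogeneous (mchar (1 - alpha) (fun x => (om x)^-1)) (pullback G).
Proof.
move=> om_lc dG hG z phi z0 tphi; rewrite (mchar_dual alpha om z0) /pullback (F_scale z0 tphi).
have tF := F_testfun tphi; have zV0 : z^-1 != 0 by rewrite invr_eq0.
rewrite (is_distributionZ _ dG (testfun_scale z0 tF)).
have -> : (fun xi => F phi (z * xi)) = (fun xi => F phi (xi / z^-1)).
  by apply/funext => x; rewrite invrK mulrC.
have E := hG _ _ zV0 tF.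
rewrite E.
rewrite mulrA.
congr (_ * _).
have n0 := normRC_neq0 R z0.
have -> : (normR R z^-1)%:C%C = (normR R z)%:C%C^-1 :> C by rewrite normRV fmorphV.
rewrite mulVKf//; have mz := mchar_neq0 alpha om_lc z0.
by apply: (mulfI mz); rewrite -(mcharM alpha om_lc z0 zV0) (mulfV z0) (mulfV mz) mchar1.
Qed.


(** The origin of the factor |t| in the normalisation at zero: on the Fourier side the Jacobians of
    [dilate] and of [F_scale] cancel, while [dilate f t] keeps its |t|^-1. The identity is exact for
    every nonzero t. *)
Lemma dilate_pullback f t (c : C) phi : is_distribution f -> testfun phi -> t != 0 ->
  dilate (pullback f) t^-1 phi / ((normR R t)%:C%C * c) =
  dilate f t (F phi) / c.
Proof.
move=> df tphi t0; have tV0 : t^-1 != 0 by rewrite invr_eq0.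
have tF := F_testfun tphi.
rewrite /dilate /pullback (F_scale tV0 tphi).
rewrite (is_distributionZ _ df (testfun_scale tV0 tF)).
have E : (fun xi : Qp => F phi (t^-1 * xi)) = (fun xi => F phi (xi / t)).
  by apply/funext => x; rewrite [t^-1 * x]mulrC.
rewrite E.
have n0 := normRC_neq0 R t0.
rewrite normRV invrK !fmorphV/= mulVKf//.
have aux (A B D : C) : B / (A * D) = A^-1 * B / D by rewrite invfM mulrCA mulrA.
exact: aux.
Qed.


Lemma cvg_dilate_pullback (rho : Qp -> C) f phi (l : C) :
  is_distribution f -> testfun phi ->
  (dilate (pullback f) t^-1 phi / ((normR R t)%:C%C * rho t) @[t --> Qp_infty pp] --> l)
  <-> (dilate f t (F phi) / rho t @[t --> Qp_infty pp] --> l).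
Proof.
move=> df tphi.
by split; apply: cvg_near_eq; apply: filterS near_infty_neq0 => t t0;
  rewrite dilate_pullback.
Qed.


Lemma qasympt_infty_pullback (alpha : C) (om rho : Qp -> C) f g :
  is_distribution f -> qasympt_infty (mchar alpha om) rho f g ->
  qasympt_zero (mchar (alpha + 1) om) (fun t => (normR R t)%:C%C * rho t)
    (pullback f) (pullback g).
Proof.
move=> df [am dg ng lg]; split.
- exact: automodel_norm.
- exact: is_distribution_pullback.
- move=> g0; apply: ng => phi tphi; have [tpsi <-] := involution_surj tphi.
  exact: g0.
- move=> phi tphi; apply/cvg_dilate_pullback => //.
  by apply: lg; exact: F_testfun.
Qed.


(** The limit h is composed with the inverse of F, namely phi |-> (F phi)(-x). No formula for h is
    required, only the surjectivity of F on test functions. *)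
Lemma qasympt_zero_pullback (alpha : C) (om rho : Qp -> C) f h :
  automodel (mchar alpha om) rho -> is_distribution f ->
  qasympt_zero (mchar (alpha + 1) om) (fun t => (normR R t)%:C%C * rho t)
    (pullback f) h ->
  exists2 g, qasympt_infty (mchar alpha om) rho f g & dist_eq h (pullback g).
Proof.
move=> am df [_ dh nh lh]; pose g phi := h (fun x => F phi (- x)).
have hg : dist_eq h (pullback g).
  move=> phi tphi; rewrite /pullback /g F_invol//.
  by congr h; apply/funext => x; rewrite opprK.
exists g; last exact: hg.
split; first exact: am.
- move=> c phi psi tphi tpsi; rewrite /g F_lin//.
  by apply: dh; [exact: (involution_surj tphi).1|exact: (involution_surj tpsi).1].
- move=> g0; apply: nh => phi tphi; rewrite hg// /pullback g0//.
  exact: F_testfun.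
- move=> phi tphi; have [tpsi E] := involution_surj tphi.
  have := lh _ tpsi; rewrite -[h _]/(g phi) => hl.
  by have := (cvg_dilate_pullback _ _ df tpsi).1 hl; rewrite E.
Qed.


End DistributionOperators.

(** * Fourier transforms of the limit distributions and the constant Gamma_p *)

Section LimitDistributions.
Variables (R : realType) (p : nat) (pp : prime p).
Variable mu : {measure set (Qp_borel pp) -> \bar R}.
Hypothesis mu_haar : normalized_haar mu.
Local Notation C := (Cplx R).
Local Notation Qp := (Qp pp).
Local Notation J := (cintegral mu [set: Qp]).
Local Notation fourier := (fourier mu).
Implicit Types (phi psi : Qp -> C) (x y z t : Qp) (f g G : functional R pp).

Lemma cintegral_fourier phi : testfun phi -> J (fourier phi) = phi 0.
Proof.
move=> tphi; have := fourier_fourier mu_haar tphi.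
move=> /(congr1 (fun h => h 0)); rewrite oppr0 => <-.
by congr (J _); apply/funext => x; rewrite mul0r chi0 mul1r.
Qed.


(** The dual character is 1 on a neighbourhood of 1, so the averages over 1 + p^n Z_p that define
    Gamma_p equal d as soon as n > k. *)
Lemma Gamma_pE (alpha d : C) (om : Qp -> C) : lc_char om ->
  (forall phi, testfun phi -> dfourier mu (dmchar mu alpha om) phi =
    d * dmchar mu (1 - alpha) (fun x => (om x)^-1) phi) ->
  Gamma_p mu alpha om = d.
Proof.
move=> om_lc hd; have omV_lc := lc_charV om_lc.
have [k hk] := mchar_lc (1 - alpha) omV_lc.
rewrite /Gamma_p /point_value; apply: cvg_lim; first exact: norm_hausdorff.
apply: cvg_near_cst; exists k.+1 => // n /= kn.
have w0 := Xp_neq0 pp n; set w := p%:R ^+ n in w0.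
have -> : (fun x : Qp => if pnorm (x - 1) <= p%:R ^- n then 1 else 0 : C) = bfun R 1 w.
  by apply/funext => x; rewrite /bfun pnormXp.
have w1 : pnorm w < 1.
  rewrite pnormXp invf_lt1 ?exprn_gt0 ?rp_gt0//.
  by rewrite exprn_egt1 ?rp_gt1// -lt0n (leq_trans _ kn).
have tb := testfun_bfun R 1 w0.
rewrite hd// dmchar_vanish//; last by rewrite /bfun sub0r pnormN pnorm1 leNgt w1.
have -> : (fun x => mchar (1 - alpha) (fun x => (om x)^-1) x * bfun R 1 w x) = bfun R 1 w.
  apply/funext => x; rewrite /bfun; case: ifPn => [xa|]; last by rewrite mulr0.
  rewrite (hk 1) ?oner_neq0 ?mchar1 ?mul1r//.
  by rewrite (le_trans xa)// mulr1 !pnormXp exppV_le.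
rewrite (cintegrable_bfun mu_haar _ _).2// normRXp fmorphV/= rmorphXn/= rmorph_nat.
have pn0 : p%:R ^+ n != 0 :> C by rewrite expf_neq0// pnatr_eq0 -lt0n prime_gt0.
by rewrite mulrCA mulfV// mulr1.
Qed.


(** Evaluating pi_alpha = 1 at p gives p^-alpha = 1/p, so [I0] is 1 = mu(Z_p): exactly the integral
    of the part phi(0) [b1] removed by the regularisation. *)
Lemma dmchar_const (alpha : C) (om : Qp -> C) phi : lc_char om ->
  (forall x, x != 0 -> mchar alpha om x = 1) -> testfun phi ->
  dmchar mu alpha om phi = J phi.
Proof.
move=> om_lc m1 tphi; rewrite dmcharE//.
have om1 : forall x, x != 0 -> om x = 1.
  apply: (lc_char_trivial om_lc) => u u1.
  by rewrite -(mchar_unit alpha om u1) m1// -pnorm_gt0 u1.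
have -> : I0 alpha om = 1.
  rewrite /I0; case: asboolP => // _.
  have p0 := Qp_p_neq0 pp; have := mcharS alpha om p0.
  rewrite m1// mulr1 /mchar addrK om1// mulr1.
  have := normRXp R pp 1; rewrite !expr1 => ->.
  rewrite cpowV ?ltr0n ?prime_gt0// -cpowN ?ltr0n ?prime_gt0// => <-.
  rewrite fmorphV/= rmorph_nat mulfV// subr_eq0 eq_sym invr_eq1 -[1]/(1%:R) eqr_nat.
  by apply: contraTneq (prime_gt1 pp) => ->.
rewrite mulr1 (is_distribution_split (is_distribution_cintegral mu_haar) tphi).
rewrite (cintegrable_bfun mu_haar _ (oner_neq0 _)).2 normR1 mulr1 addrC; congr (_ + J _).
apply/funext => x; have [->|x0] := eqVneq x 0; last by rewrite m1// mul1r.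
by rewrite bfun_center mulr1 subrr mulr0.
Qed.


(** Three cases: F[delta] = 1, F[1] = delta by inversion at 0, and otherwise uniqueness of
    homogeneous distributions in the dual degree, whose factor is identified by [Gamma_pE]. *)
Lemma dfourier_infty_limit (alpha c : C) (om : Qp -> C) : lc_char om ->
  dist_eq (dfourier mu (infty_limit mu c alpha om)) (zero_limit mu c alpha om).
Proof.
move=> om_lc phi tphi; have tF := testfun_fourier mu_haar tphi.
rewrite /infty_limit /zero_limit /dfourier; case: asboolP => [_|n0].
  rewrite /Defs.dscale /delta /dconst1; congr (_ * _); congr (J _).
  by apply/funext => x; rewrite mul0r chi0 mul1r.
case: asboolP => [m1|n1].
  by rewrite /Defs.dscale /delta (dmchar_const om_lc m1 tF) cintegral_fourier.
have omV_lc := lc_charV om_lc.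
have dT := is_distribution_dmchar mu_haar alpha om_lc.
have [|d hd] := homogeneous_unique mu_haar omV_lc _
  (is_distribution_pullback (fourier_lin mu_haar) (testfun_fourier mu_haar) dT)
  (homogeneous_pullback (testfun_fourier mu_haar) (fourier_scale mu_haar) om_lc dT
    (dmchar_homogeneous mu_haar om_lc n0)).
  (* Uniqueness requires the dual degree to differ from pi_0; were they equal, the duality relation
     would give pi_alpha = 1, the case already treated. *)
  move=> h; apply: n1 => x x0; have := mchar_dual alpha om x0.
  rewrite h// /pi0 fmorphV/= mulfV; last exact: normRC_neq0.
  by move/eqP; rewrite eq_sym invr_eq1 => /eqP.
by rewrite /Defs.dscale (Gamma_pE om_lc hd) -mulrA -hd.
Qed.


Lemma qasympt_infty_limit (alpha : C) (om rho : Qp -> C) f g : lc_char om ->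
  qasympt_infty (mchar alpha om) rho f g ->
  exists2 c : C, c != 0 & dist_eq g (infty_limit mu c alpha om).
Proof.
move=> om_lc hg; have hom := qasympt_infty_homogeneous om_lc hg.
case: hg => _ dg ng _.
suff [c hc] : exists c, dist_eq g (infty_limit mu c alpha om).
  exists c => //; apply: contra_notN ng => /eqP c0 phi tphi; rewrite hc// c0.
  by rewrite /infty_limit /Defs.dscale; case: ifP; rewrite mul0r.
rewrite /infty_limit; case: asboolP => [m0|n0].
  by have [c hc] := homogeneous_pi0 mu_haar om_lc m0 dg hom; exists c.
by have [c hc] := homogeneous_unique mu_haar om_lc n0 dg hom; exists c.
Qed.


End LimitDistributions.

Theorem corollary7p1 (R : realType) (p : nat) (pp : prime p)
    (mu : {measure set (Qp_borel pp) -> \bar R}) (mu_haar : normalized_haar mu)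
    (alpha : Cplx R) (pi1 : Qp pp -> Cplx R) (pi1_char : normed_char pi1)
    (rho : Qp pp -> Cplx R) (rho_automodel : automodel (mchar alpha pi1) rho)
    (f : functional R pp) (f_dist : is_distribution f) :
  let at_infty := qasympt_infty (mchar alpha pi1) rho f in
  let at_zero := qasympt_zero (mchar (alpha + 1) pi1)
                   (fun t => (normR R t)%:C%C * rho t) (dfourier mu f) in
  [/\ (exists g, at_infty g) <-> (exists h, at_zero h),
      (exists g, at_infty g) <->
        (exists2 c : Cplx R, c != 0 & at_infty (infty_limit mu c alpha pi1)),
      (exists h, at_zero h) <->
        (exists2 c : Cplx R, c != 0 & at_zero (zero_limit mu c alpha pi1)),
      (forall c : Cplx R, dist_eq (dfourier mu (infty_limit mu c alpha pi1))
                         (zero_limit mu c alpha pi1))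
    & forall c : Cplx R, c != 0 ->
        (at_infty (infty_limit mu c alpha pi1) <->
         at_zero (zero_limit mu c alpha pi1))].
Proof.
move=> at_infty at_zero; have om_lc := normed_char_lc pi1_char.
have lim_eq c := @dfourier_infty_limit R p pp mu mu_haar alpha c pi1 om_lc.
have to_zero g : at_infty g -> at_zero (dfourier mu g).
  apply: (qasympt_infty_pullback (fourier_lin mu_haar) (testfun_fourier mu_haar)
    (fourier_scale mu_haar) (fourier_fourier mu_haar)) f_dist.
have to_infty h : at_zero h -> exists2 g, at_infty g & dist_eq h (dfourier mu g).
  apply: (qasympt_zero_pullback (fourier_lin mu_haar) (testfun_fourier mu_haar)
    (fourier_scale mu_haar) (fourier_fourier mu_haar)) rho_automodel f_dist.
have infty_form g : at_infty g -> exists2 c : Cplx R, c != 0 &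
    at_infty (infty_limit mu c alpha pi1) /\ dist_eq g (infty_limit mu c alpha pi1).
  move=> hg; have [c c0 gc] := qasympt_infty_limit mu_haar om_lc hg.
  by exists c; [|split; [exact: qasympt_infty_eq gc hg|]].
have infty_zero c : at_infty (infty_limit mu c alpha pi1) ->
    at_zero (zero_limit mu c alpha pi1).
  by move=> /to_zero; exact: qasympt_zero_eq (lim_eq c).
split.
- split=> [[g /to_zero hg]|[h /to_infty[g hg _]]]; last by exists g.
  by exists (dfourier mu g).
- split=> [[g /infty_form[c c0 [hc _]]]|[c _ hc]]; first by exists c.
  by eexists; exact: hc.
- split=> [[h /to_infty[g /infty_form[c c0 [hc _]] _]]|[c _ hc]].
    by exists c; [exact: c0|exact: infty_zero].
  by eexists; exact: hc.
- exact: lim_eq.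
- move=> c c0; split; first exact: infty_zero.
  (* The constant is preserved because g and the expected limit have the same Fourier transform on
     test functions, and every test function is itself a transform. *)
  move=> /to_infty[g hg gE].
  apply: qasympt_infty_eq hg => phi tphi; have [tpsi <-] := involution_surj
    (testfun_fourier mu_haar) (fourier_scale mu_haar) (fourier_fourier mu_haar) tphi.
  exact: etrans (esym (gE _ tpsi)) (esym (lim_eq c _ tpsi)).
Qed.
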